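(* Fix $0<p<2$ and $\eta>0$. Then $$\lim_{n\to\infty}\frac{R_n^*(M_{n,p}(\eta))}{\bar R_n^*(M_{n,p}(\eta))}=1.$$
   Context: Observations: $X_i\sim\mathrm{Exp}(\mu_i)$ independent (mean $\mu_i$), $i=1,\dots,n$, with $\mu_i\ge1$. $M_{n,p}(\eta)=\{\mu\in[1,\infty)^n:\frac1n\sum_i\log^p\mu_i\le\eta^p\}$. Minimax risk: $R_n^*(M_{n,p}(\eta))=\inf_{\hat\mu}\sup_{\mu\in M_{n,p}(\eta)}\mathbb{E}_\mu[\frac1n\|\log\hat\mu-\log\mu\|_2^2]$, infimum over estimators with values in $(0,\infty)^n$ (log taken coordinatewise). Minimax-Bayes risk: $\bar R_n^*(M_{n,p}(\eta))=\inf_{\hat\mu}\sup_\pi\{\mathbb{E}_\pi\mathbb{E}_\mu[\frac1n\|\log\hat\mu-\log\mu\|_2^2]:\ \mathbb{E}_\pi[\frac1n\sum_{i=1}^n\log^p\mu_i]\le\eta^p\}$, where the supremum is over prior distributions $\pi$ on $[1,\infty)^n$ for the random vector $\mu$, and given $\mu$ the $X_i$ are independent $\mathrm{Exp}(\mu_i)$. *)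

(* Defs.v *)
From HB Require Import structures.
From mathcomp Require Import all_boot all_order all_algebra.
From mathcomp Require Import all_classical all_reals all_analysis.
Unset Printing Implicit Defensive.
Import Order.TTheory GRing.Theory Num.Theory.
Import numFieldNormedType.Exports.
Local Open Scope classical_set_scope.
Local Open Scope ring_scope.

Section Defs.
Context {R : realType}.

Definition exp_mean_pdf (m x : R) : R := m^-1 * expR (- (x / m)).

(* E_mu[f(X)] for X = (X_1,..,X_n) with independent X_i ~ Exp(mean mu_i):
   integral of f against the product of the n exponential laws, written as an
   iterated Lebesgue integral (Tonelli) over the coordinates. *)
Fixpoint exp_expect (n : nat) : n.-tuple R -> (n.-tuple R -> \bar R) -> \bar R :=
  match n with
  | 0 => fun _ f => f [tuple]
  | n'.+1 => fun (mu : n'.+1.-tuple R) f =>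
      (\int[@lebesgue_measure R]_(x in (`[0%R, +oo[%classic : set R))
        ((exp_mean_pdf (thead mu) x)%:E *
          exp_expect n' [tuple of behead mu] (fun t => f [tuple of x :: t])))%E
  end.

Definition ge1_set (n : nat) : set (n.-tuple R) :=
  [set mu | forall i : 'I_n, 1 <= tnth mu i].

Definition logp_mean (n : nat) (p : R) (mu : n.-tuple R) : R :=
  n%:R^-1 * \sum_(i < n) powR (ln (tnth mu i)) p.

Definition Mset (n : nat) (p eta : R) : set (n.-tuple R) :=
  [set mu | ge1_set n mu /\ logp_mean n p mu <= powR eta p].

Definition estimator (n : nat) (muhat : n.-tuple R -> n.-tuple R) : Prop :=
  measurable_fun [set: n.-tuple R] muhat /\
  forall x i, 0 < tnth (muhat x) i.

Definition logloss (n : nat) (est mu : n.-tuple R) : R :=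
  n%:R^-1 * \sum_(i < n) (ln (tnth est i) - ln (tnth mu i)) ^+ 2.

Definition risk (n : nat) (muhat : n.-tuple R -> n.-tuple R) (mu : n.-tuple R)
  : \bar R := exp_expect n mu (fun x => (logloss n (muhat x) mu)%:E).

Definition minimax_risk (n : nat) (p eta : R) : \bar R :=
  ereal_inf [set r | exists muhat, estimator n muhat /\
    r = ereal_sup [set risk n muhat mu | mu in Mset n p eta]].

Definition admissible_prior (n : nat) (p eta : R)
  (pi : probability (n.-tuple R) R) : Prop :=
  pi (ge1_set n) = 1%E /\
  (\int[pi]_(mu in ge1_set n) (logp_mean n p mu)%:E <= (powR eta p)%:E)%E.

Definition bayes_risk (n : nat) (pi : probability (n.-tuple R) R)
  (muhat : n.-tuple R -> n.-tuple R) : \bar R :=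
  (\int[pi]_(mu in ge1_set n) risk n muhat mu)%E.

Definition minimax_bayes_risk (n : nat) (p eta : R) : \bar R :=
  ereal_inf [set r | exists muhat, estimator n muhat /\
    r = ereal_sup [set r' | exists pi, admissible_prior n p eta pi /\
                               r' = bayes_risk n pi muhat]].

End Defs.

(* Main.v *)
Require Import Defs.
From HB Require Import structures.
From mathcomp Require Import all_boot all_order all_algebra.
From mathcomp Require Import all_classical all_reals all_analysis.
From mathcomp Require Import measurable_realfun.
From mathcomp Require Import ring lra.
Import Order.TTheory GRing.Theory Num.Theory.
Import numFieldNormedType.Exports.
Local Open Scope classical_set_scope.
Local Open Scope ring_scope.

(* Write [th = ln mu] and [s = eta ^ p].  A point mass at [mu] in [Mset] is an
   admissible prior, so the minimax risk is at most the minimax Bayes risk; it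
   remains to bound both by the value [V] of one univariate game, up to an
   arbitrarily small error; [V] is bounded away from [0] for large [T] and [M].

   The game: the statistician sees one exponential observation [x] and pays the
   squared error only when [x <= T]; nature plays a finitely supported prior on
   [[1, M]] with mean of [th ^ p] at most [s].  On [[0, T]] every marginal density
   is at least [exp (- T) / M], which makes the Bayes rule stable under
   perturbations of the prior: no compactness is needed for the minimax theorem.
   Since the Bayes risk is concave, the moment constraint can be replaced by a
   linear penalty, and the Bayes rule of a nearly least favorable prior has risk at
   most [V + e + l * (th ^ p - s)] at every mean in [[1, M]].

   Upper bound: apply this rule to each coordinate [x <= T] and estimate the mean
   by [x] itself beyond [T].  The bound, increased by [kap * th ^ p], then holds
   for all means [>= 1], and integrating it against any admissible prior gives
   [V + e + kap * s].

   Lower bound: take independent coordinates from a nearly least favorable prior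
   whose moment is slightly below [s].  Each coordinate costs at least the
   univariate Bayes risk, whatever the estimator does with the other ones, and by
   Chebyshev's inequality the mean vector lies in [Mset] up to probability
   [O(1 / n)]. *)

(** * Iterated exponential expectations *)

Section NonnegIntegral.
Context d (T : measurableType d) (R : realType) (mu : {measure set T -> \bar R}).
Import HBNNSimple.

(* Unlike [ge0_le_integral], no measurability is required. *)
Lemma ge0_le_integral_sup (D : set T) (f g : T -> \bar R) :
  (forall x, D x -> 0 <= f x)%E -> (forall x, D x -> f x <= g x)%E ->
  (\int[mu]_(x in D) f x <= \int[mu]_(x in D) g x)%E.
Proof.
move=> f0 fg; rewrite !ge0_integralE//; last first.
  by move=> x Dx; exact: le_trans (f0 _ Dx) (fg _ Dx).
apply: ge_ereal_sup => _ [h /= hf <-]; apply: ereal_sup_ubound => /=.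
exists h => // x; apply: le_trans (hf x) _.
by rewrite /patch; case: ifPn => // /set_mem; exact: fg.
Qed.

End NonnegIntegral.

Section Expectation.
Context {R : realType}.
Local Notation leb := (@lebesgue_measure R).
Local Notation halfline := (`[0%R, +oo[%classic : set R).

Lemma continuous_exp_mean_pdf (m : R) : continuous (exp_mean_pdf m).
Proof.
move=> x; apply: cvgM; first exact: cvg_cst.
apply: continuous_comp; last exact: continuous_expR.
by apply: cvgN; apply: cvgM; [exact: cvg_id | exact: cvg_cst].
Qed.

Lemma measurable_exp_mean_pdf (m : R) : measurable_fun setT (exp_mean_pdf m).
Proof. by apply: continuous_measurable_fun; exact: continuous_exp_mean_pdf. Qed.

Lemma exp_mean_pdf_gt0 (m x : R) : 0 < m -> 0 < exp_mean_pdf m x.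
Proof. by move=> m0; rewrite mulr_gt0 ?invr_gt0 ?expR_gt0. Qed.

Lemma exp_mean_pdf_ge0 (m x : R) : 0 < m -> 0 <= exp_mean_pdf m x.
Proof. by move=> /exp_mean_pdf_gt0 /ltW. Qed.

Lemma integral_exp_mean_pdf (m : R) : 0 < m ->
  (\int[leb]_(x in halfline) (exp_mean_pdf m x)%:E = 1)%E.
Proof.
move=> m0; have mi : 0 < m^-1 by rewrite invr_gt0.
rewrite -(integral_exponential_pdf mi) [RHS]integral_mkcond [LHS]integral_mkcond.
apply: eq_integral => x _; rewrite /patch mem_setT /exponential_pdf /patch.
by case: ifP => // _; rewrite /exp_mean_pdf mulNr [x / m]mulrC.
Qed.

(** The parameter [y] is there for the induction: integrating out the first observation makes that
    observation a parameter of the remaining expectation. Tonelli's theorem then gives measurability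
    of the partial integral, and it needs nonnegativity, so both facts are proved together. *)
Lemma measurable_exp_expect d (T : measurableType d) (n : nat) (mu : n.-tuple R)
    (F : T -> n.-tuple R -> \bar R) : (forall i, 0 < tnth mu i) ->
  (forall y x, 0 <= F y x)%E ->
  measurable_fun setT (fun z : T * n.-tuple R => F z.1 z.2) ->
  measurable_fun setT (fun y => exp_expect n mu (F y)) /\
  forall y, (0 <= exp_expect n mu (F y))%E.
Proof.
elim: n d T mu F => [|n IH] d T mu F mu0 F0 mF /=.
  split => //.
  apply: (measurableT_comp (f := fun z : T * 0.-tuple R => F z.1 z.2)
                           (g := fun y => (y, [tuple])) mF).
  by apply: measurable_fun_pair; [exact: measurable_id | exact: measurable_cst].
have hmu0 : 0 < thead mu by exact: mu0.
have tmu0 i : 0 < tnth [tuple of behead mu] i by rewrite tnth_behead.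
pose H (z : T * measurableTypeR R) (t : n.-tuple R) := F z.1 [tuple of z.2 :: t].
have mH : measurable_fun setT (fun w : (T * measurableTypeR R) * n.-tuple R => H w.1 w.2).
  apply: (measurableT_comp (f := fun z : T * n.+1.-tuple R => F z.1 z.2)
    (g := fun w : (T * measurableTypeR R) * n.-tuple R =>
      (w.1.1, [tuple of w.1.2 :: w.2])) mF).
  apply: measurable_fun_pair; first exact: measurableT_comp.
  apply: measurable_cons; last exact: measurable_snd.
  exact: measurableT_comp.
have [mE E0] := IH _ _ [tuple of behead mu] H tmu0 (fun z t => F0 z.1 _) mH.
split; last first.
    move=> y; apply: integral_ge0 => x _; apply: mule_ge0; last exact: (E0 (y, x)).
    by rewrite lee_fin exp_mean_pdf_ge0.
  (* Extending the integrand by zero outside the half-line [A] turns the integral into one over the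
     whole line, as [fubini_F] expects. *)
  pose G (z : T * measurableTypeR R) := ((exp_mean_pdf (thead mu) z.2)%:E *
    exp_expect n [tuple of behead mu] (fun t => F z.1 [tuple of z.2 :: t]))%E.
  pose A : set (T * measurableTypeR R) := snd @^-1` halfline.
  have mA : measurable A.
    by rewrite -[A]setTI; apply: measurable_snd => //; exact: measurable_itv.
  have mG : measurable_fun setT (G \_ A).
    apply/(measurable_restrictT _ mA)/measurable_funTS/emeasurable_funM => //.
    apply/measurable_EFinP; apply: (measurableT_comp (measurable_exp_mean_pdf _)).
    exact: measurable_snd.
  have G0 z : (0 <= (G \_ A) z)%E.
    apply: erestrict_ge0 => w _; apply: mule_ge0; last exact: E0.
    by rewrite lee_fin exp_mean_pdf_ge0.
  have := measurable_fun_fubini_tonelli_F (m2 := leb) (G \_ A) mG G0.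
  congr (measurable_fun _ _); apply/funext => y.
  rewrite /fubini_F [RHS]integral_mkcond; apply: eq_integral => x _.
  rewrite /patch /A /G /=.
  by have -> : ((y, x) \in (snd @^-1` halfline : set (T * R))) = (x \in halfline)
    by apply/idP/idP; rewrite !inE.
Qed.

Section FixedMean.
Variables (n : nat) (mu : n.-tuple R).
Hypothesis mu_gt0 : forall i, 0 < tnth mu i.

Lemma exp_expect_ge0 (F : n.-tuple R -> \bar R) :
  (forall x, 0 <= F x)%E -> measurable_fun setT F -> (0 <= exp_expect n mu F)%E.
Proof.
move=> F0 mF.
have [//|_] := measurable_exp_expect _ unit n mu (fun _ => F) mu_gt0 (fun _ => F0).
  by apply: (measurableT_comp mF); exact: measurable_snd.
by apply; exact: tt.
Qed.

End FixedMean.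

(** Side conditions shared by the inductive proofs below: fixing the first observation leaves a
    nonnegative measurable function of the others, whose expectation is measurable in the fixed
    one. *)
Lemma exp_expect_tailP (n : nat) (mu : n.+1.-tuple R) (F : n.+1.-tuple R -> \bar R) :
  (forall i, 0 < tnth mu i) -> (forall x, 0 <= F x)%E -> measurable_fun setT F ->
  [/\ 0 < thead mu, forall i, 0 < tnth [tuple of behead mu] i,
      forall x, measurable_fun setT (fun t : n.-tuple R => F [tuple of x :: t]),
      measurable_fun setT (fun x => exp_expect n [tuple of behead mu]
                                     (fun t => F [tuple of x :: t])) &
      forall x, (0 <= exp_expect n [tuple of behead mu]
                                     (fun t => F [tuple of x :: t]))%E].
Proof.
move=> mu0 F0 mF.
have tmu0 i : 0 < tnth [tuple of behead mu] i by rewrite tnth_behead.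
have [||mE E0] := measurable_exp_expect _ (measurableTypeR R) n
  [tuple of behead mu] (fun x t => F [tuple of x :: t]) tmu0.
- by [].
- apply: (measurableT_comp mF).
  by apply: measurable_cons; [exact: measurable_fst | exact: measurable_snd].
split=> //; first exact: mu0.
move=> x; apply: (measurableT_comp mF).
by apply: measurable_cons.
Qed.

Lemma eq_exp_expect (n : nat) (mu : n.-tuple R) (F G : n.-tuple R -> \bar R) :
  F =1 G -> exp_expect n mu F = exp_expect n mu G.
Proof. by move=> /funext ->. Qed.

Lemma measurable_exp_integrand (m : R) (f : R -> \bar R) :
  measurable_fun setT f ->
  measurable_fun halfline (fun x => ((exp_mean_pdf m x)%:E * f x)%E).
Proof.
move=> mf; apply: measurable_funTS; apply: emeasurable_funM => //.
apply/measurable_EFinP; exact: measurable_exp_mean_pdf.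
Qed.

Lemma exp_expectD (n : nat) (mu : n.-tuple R) (F G : n.-tuple R -> \bar R) :
  (forall i, 0 < tnth mu i) ->
  (forall x, 0 <= F x)%E -> measurable_fun setT F ->
  (forall x, 0 <= G x)%E -> measurable_fun setT G ->
  exp_expect n mu (fun x => F x + G x)%E =
  (exp_expect n mu F + exp_expect n mu G)%E.
Proof.
elim: n mu F G => [//|n IH] mu F G mu0 F0 mF G0 mG /=.
have [hmu tmu mFx mEF EF0] := exp_expect_tailP _ _ _ mu0 F0 mF.
have [_ _ mGx mEG EG0] := exp_expect_tailP _ _ _ mu0 G0 mG.
rewrite -ge0_integralD//.
- apply: eq_integral => x _.
  by rewrite IH// ge0_muleDr.
- by move=> x _; rewrite mule_ge0// lee_fin exp_mean_pdf_ge0.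
- exact: measurable_exp_integrand.
- by move=> x _; rewrite mule_ge0// lee_fin exp_mean_pdf_ge0.
- exact: measurable_exp_integrand.
Qed.

Lemma exp_expectZ (n : nat) (mu : n.-tuple R) (c : R) (F : n.-tuple R -> \bar R) :
  (forall i, 0 < tnth mu i) -> 0 <= c ->
  (forall x, 0 <= F x)%E -> measurable_fun setT F ->
  exp_expect n mu (fun x => c%:E * F x)%E = (c%:E * exp_expect n mu F)%E.
Proof.
elim: n mu F => [//|n IH] mu F mu0 c0 F0 mF /=.
have [hmu tmu mFx mEF EF0] := exp_expect_tailP _ _ _ mu0 F0 mF.
rewrite -ge0_integralZl//.
- by apply: eq_integral => x _; rewrite IH// muleCA.
- exact: measurable_exp_integrand.
- by move=> x _; rewrite mule_ge0// lee_fin exp_mean_pdf_ge0.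
Qed.

Lemma le_exp_expect (n : nat) (mu : n.-tuple R) (F G : n.-tuple R -> \bar R) :
  (forall i, 0 < tnth mu i) ->
  (forall x, 0 <= F x)%E -> measurable_fun setT F -> measurable_fun setT G ->
  (forall x, F x <= G x)%E ->
  (exp_expect n mu F <= exp_expect n mu G)%E.
Proof.
elim: n mu F G => [|n IH] mu F G mu0 F0 mF mG FG /=; first exact: FG.
have G0 x : (0 <= G x)%E by exact: le_trans (F0 x) (FG x).
have [hmu tmu mFx mEF EF0] := exp_expect_tailP _ _ _ mu0 F0 mF.
have [_ _ mGx mEG EG0] := exp_expect_tailP _ _ _ mu0 G0 mG.
apply: ge0_le_integral_sup => x _.
  by rewrite mule_ge0// lee_fin exp_mean_pdf_ge0.
apply: lee_wpmul2l; first by rewrite lee_fin exp_mean_pdf_ge0.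
exact: IH.
Qed.

Lemma exp_expect_cst (n : nat) (mu : n.-tuple R) (c : R) :
  (forall i, 0 < tnth mu i) -> 0 <= c -> exp_expect n mu (fun=> c%:E) = c%:E.
Proof.
elim: n mu => [//|n IH] mu mu0 c0 /=.
have hmu : 0 < thead mu by exact: mu0.
transitivity (\int[leb]_(x in halfline) (c%:E * (exp_mean_pdf (thead mu) x)%:E))%E.
  by apply: eq_integral => x _; rewrite IH// => [|i]; rewrite ?tnth_behead// muleC.
rewrite ge0_integralZl ?lee_fin ?integral_exp_mean_pdf ?mule1//.
- by apply: measurable_funTS; apply/measurable_EFinP; exact: measurable_exp_mean_pdf.
- by move=> x _; rewrite lee_fin exp_mean_pdf_ge0.
Qed.

Lemma exp_expect_sum (n : nat) (mu : n.-tuple R) (I : Type) (s : seq I)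
    (F : I -> n.-tuple R -> \bar R) :
  (forall i, 0 < tnth mu i) ->
  (forall k x, 0 <= F k x)%E -> (forall k, measurable_fun setT (F k)) ->
  exp_expect n mu (fun x => \sum_(k <- s) F k x)%E =
  (\sum_(k <- s) exp_expect n mu (F k))%E.
Proof.
move=> mu0 F0 mF; elim: s => [|k s IH].
  rewrite big_nil; under eq_exp_expect do rewrite big_nil.
  exact: exp_expect_cst.
rewrite big_cons -IH -exp_expectD//.
- by apply: eq_exp_expect => x; rewrite big_cons.
- by move=> x; exact: sume_ge0.
- by apply: emeasurable_sum.
Qed.

(** All other coordinates integrate to one: those before [i] because the inner expectation does not
    depend on them, those after [i] because the integrand is constant in them. *)
Lemma exp_expect_coord (n : nat) (mu : n.-tuple R) (i : 'I_n) (h : R -> R) :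
  (forall i, 0 < tnth mu i) -> (forall x, 0 <= h x) -> measurable_fun setT h ->
  exp_expect n mu (fun x => (h (tnth x i))%:E) =
  (\int[leb]_(x in halfline) (exp_mean_pdf (tnth mu i) x * h x)%:E)%E.
Proof.
elim: n mu i => [mu [] //|n IH] mu i mu0 h0 mh /=.
have hmu : 0 < thead mu by exact: mu0.
have tmu j : 0 < tnth [tuple of behead mu] j by rewrite tnth_behead.
case: (unliftP ord0 i) => [j|] ->.
  under eq_integral => x _ do
    (under eq_exp_expect do rewrite tnthS; rewrite IH//).
  rewrite tnth_behead (_ : inord j.+1 = lift ord0 j); last first.
    by apply: val_inj; rewrite /= inordK ?ltnS ?ltn_ord// /bump leq0n.
  under eq_integral do rewrite muleC.
  rewrite ge0_integralZl ?integral_exp_mean_pdf ?mule1//.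
  - by apply: measurable_funTS; apply/measurable_EFinP; exact: measurable_exp_mean_pdf.
  - by move=> x _; rewrite lee_fin exp_mean_pdf_ge0.
  - by apply: integral_ge0 => x _; rewrite lee_fin mulr_ge0 ?exp_mean_pdf_ge0.
apply: eq_integral => x _.
under eq_exp_expect do rewrite tnth0.
by rewrite exp_expect_cst// EFinM.
Qed.

End Expectation.

(** * The truncated univariate game *)

Section Supergradient.
Context {R : realType}.

(** The multiplier is the supremum of the slopes from the point [(s, V)] to the points [(m x, B x)]
    lying to its right. Mixing a point on the right with one on the left bounds every such slope by
    the slope on the left, and the strictly feasible [x0] makes the supremum finite. *)
Lemma supergradient (X : Type) (P : X -> Prop) (B m : X -> R) (s V : R) (x0 : X) :
  (forall x y (a : R), P x -> P y -> 0 <= a <= 1 ->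
     exists z, [/\ P z, m z = a * m x + (1 - a) * m y &
                   a * B x + (1 - a) * B y <= B z]) ->
  (forall x, P x -> m x <= s -> B x <= V) ->
  P x0 -> m x0 < s ->
  exists2 l : R, 0 <= l & forall x, P x -> B x <= V + l * (m x - s).
Proof.
move=> mix leV Px0 mx0.
(* Including [0] makes the supremum nonnegative, even when no point lies to the right of [s]. *)
pose E := [set r | r = 0 \/ exists x, [/\ P x, s < m x & r = (B x - V) / (m x - s)]].
have ub x r : P x -> m x < s -> E r -> r <= (V - B x) / (s - m x).
  move=> Px mx [->|[y [Py my ->]]].
    by rewrite divr_ge0 ?subr_ge0 ?(ltW mx)// leV// ltW.
  have d0 : 0 < m y - m x by lra.
  (* The weight for which the mixture has moment exactly [s], so that its value is at most [V]. *)
  pose a := (m y - s) / (m y - m x).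
  have a01 : 0 <= a <= 1.
    by apply/andP; split; [apply: divr_ge0; lra | rewrite ler_pdivrMr//; lra].
  have [z [Pz mz Bz]] := mix _ _ _ Px Py a01.
  have mzs : m z = s by rewrite mz /a; field; lra.
  have BzV : B z <= V by apply: leV => //; rewrite mzs.
  rewrite ler_pdivrMr ?subr_gt0// mulrAC ler_pdivlMr ?subr_gt0//.
  have := le_trans Bz BzV.
  have -> : 1 - a = (s - m x) / (m y - m x) by rewrite /a; field; lra.
  rewrite /a ![_ / _ * _]mulrAC -mulrDl ler_pdivrMr//; lra.
have E0 : E 0 by left.
have hE : has_sup E by split; [exists 0 | exists ((V - B x0) / (s - m x0)) => r /(ub _ _ Px0 mx0)].
exists (sup E); first exact: (ub_le_sup hE.2).
move=> x Px; have [mx|mx|mx] := ltgtP (m x) s.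
- have : sup E <= (V - B x) / (s - m x).
    by apply: ge_sup => [|r /(ub _ _ Px mx)//]; exact: hE.1.
  by rewrite ler_pdivlMr ?subr_gt0//; lra.
- have : (B x - V) / (m x - s) <= sup E.
    by apply: (ub_le_sup hE.2); right; exists x.
  by rewrite ler_pdivrMr ?subr_gt0//; lra.
- by rewrite mx subrr mulr0 addr0 leV// mx.
Qed.

End Supergradient.

(* A finitely supported prior is the list of its pairs (weight, mean). *)
Section Priors.
Context {R : realType}.
Implicit Types (pi rho : seq (R * R)) (g : R -> R).

Definition pmean pi g : R := \sum_(q <- pi) q.1 * g q.2.

Definition is_prior (M : R) pi : Prop :=
  (forall q, q \in pi -> [/\ 0 <= q.1, 1 <= q.2 & q.2 <= M]) /\
  pmean pi (fun=> 1) = 1.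

Definition mixture (a : R) pi rho : seq (R * R) :=
  [seq (a * q.1, q.2) | q <- pi] ++ [seq ((1 - a) * q.1, q.2) | q <- rho].

Lemma pmean_mixture a pi rho g :
  pmean (mixture a pi rho) g = a * pmean pi g + (1 - a) * pmean rho g.
Proof.
rewrite /pmean big_cat !big_map /= !mulr_sumr.
by congr (_ + _); apply: eq_bigr => q _; rewrite mulrA.
Qed.

Lemma pmean_dirac m g : pmean [:: (1, m)] g = g m.
Proof. by rewrite /pmean big_seq1 mul1r. Qed.

Lemma pmeanD pi g h : pmean pi (fun m => g m + h m) = pmean pi g + pmean pi h.
Proof. by rewrite /pmean -big_split; apply: eq_bigr => q _; rewrite mulrDr. Qed.

Lemma pmeanZ pi c g : pmean pi (fun m => c * g m) = c * pmean pi g.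
Proof. by rewrite /pmean mulr_sumr; apply: eq_bigr => q _; rewrite mulrCA. Qed.

Lemma le_pmean M pi g h : is_prior M pi ->
  (forall m, 1 <= m -> m <= M -> g m <= h m) -> pmean pi g <= pmean pi h.
Proof.
move=> [wf _] gh; rewrite /pmean big_seq [leRHS]big_seq.
by apply: ler_sum => q /wf[w0 m1 mM]; rewrite ler_wpM2l ?gh.
Qed.

Lemma pmean_cst M pi c : is_prior M pi -> pmean pi (fun=> c) = c.
Proof.
move=> [_ w1]; rewrite -[c in LHS]mulr1.
by rewrite (pmeanZ pi c (fun=> 1)) w1 mulr1.
Qed.

Lemma is_prior_dirac (M m : R) : 1 <= m -> m <= M -> is_prior M [:: (1, m)].
Proof.
move=> m1 mM; split; last by rewrite pmean_dirac.
by move=> q; rewrite inE => /eqP ->.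
Qed.

Lemma is_prior_mixture (M a : R) pi rho : 0 <= a <= 1 ->
  is_prior M pi -> is_prior M rho -> is_prior M (mixture a pi rho).
Proof.
move=> /andP[a0 a1] [wpi spi] [wrho srho]; split; last first.
  by rewrite pmean_mixture spi srho; ring.
move=> q; rewrite mem_cat => /orP[] /mapP[r + ->] /=.
- by move=> /wpi[w0 m1 mM]; rewrite mulr_ge0.
- by move=> /wrho[w0 m1 mM]; rewrite mulr_ge0// subr_ge0.
Qed.

End Priors.

(** * Bayes rules, Bayes risk and value of the truncated game *)

Section TruncatedGame.
Context {R : realType}.
Local Notation leb := (@lebesgue_measure R).
Implicit Types (pi rho : seq (R * R)).

Definition marginal pi (x : R) : R := pmean pi (fun m => exp_mean_pdf m x).

(** The posterior mean of [ln m] given the observation [x]. *)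
Definition bayes_est pi (x : R) : R :=
  pmean pi (fun m => ln m * exp_mean_pdf m x) / marginal pi x.

(** The posterior expected loss times the marginal density. Without normalization it is linear in
    the prior, and its integral over [x] is the Bayes risk of the rule that chooses [d] at [x]. *)
Definition wloss pi (d x : R) : R :=
  pmean pi (fun m => exp_mean_pdf m x * (d - ln m) ^+ 2).

Definition trunc_int (T : R) (h : R -> R) : R := \int[leb]_(x in `[0, T]%classic) h x.

Definition trunc_bayes (T : R) pi : R :=
  trunc_int T (fun x => wloss pi (bayes_est pi x) x).

Lemma trunc_integrable T (h : R -> R) : continuous h ->
  leb.-integrable `[0, T] (EFin \o h).
Proof.
move=> ch; apply: continuous_compact_integrable; first exact: segment_compact.
exact: continuous_subspaceT.
Qed.

Lemma trunc_intD T (g h : R -> R) : continuous g -> continuous h ->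
  trunc_int T (fun x => g x + h x) = trunc_int T g + trunc_int T h.
Proof. by move=> cg ch; apply: RintegralD => //; exact: trunc_integrable. Qed.

Lemma trunc_intZ T (c : R) (h : R -> R) : continuous h ->
  trunc_int T (fun x => c * h x) = c * trunc_int T h.
Proof. by move=> ch; apply: RintegralZl => //; exact: trunc_integrable. Qed.

Lemma le_trunc_int (T : R) (g h : R -> R) : continuous g -> continuous h ->
  (forall x, 0 <= x -> x <= T -> g x <= h x) -> trunc_int T g <= trunc_int T h.
Proof.
move=> cg ch gh; apply: le_Rintegral => //; [exact: trunc_integrable..|].
by move=> x; rewrite /= in_itv/= => /andP[x0 xT]; exact: gh.
Qed.

Lemma trunc_int_cst (T c : R) : 0 <= T -> trunc_int T (fun=> c) = c * T.
Proof.
move=> T0; rewrite /trunc_int Rintegral_cst//; congr (_ * _).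
have -> : fine (leb `[0%R, T]%classic) = T; last by [].
rewrite lebesgue_measure_itv /= lte_fin.
by case: ltP => [_|T0']; rewrite /= ?subr0//; apply/eqP; rewrite eq_le T0 T0'.
Qed.

Lemma continuous_pmean pi (g : R -> R -> R) : (forall m, continuous (g m)) ->
  continuous (fun x => pmean pi (fun m => g m x)).
Proof.
move=> cg; elim: pi => [|q pi IH] x.
  by under eq_fun do rewrite /pmean big_nil; exact: cvg_cst.
under eq_fun do rewrite /pmean big_cons.
apply: cvgD; last exact: IH.
by apply: cvgM; [exact: cvg_cst | exact: cg].
Qed.

Lemma continuous_funM (g h : R -> R) :
  continuous g -> continuous h -> continuous (fun x => g x * h x).
Proof. by move=> cg ch x; apply: cvgM; [exact: cg | exact: ch]. Qed.

Lemma continuous_funD (g h : R -> R) :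
  continuous g -> continuous h -> continuous (fun x => g x + h x).
Proof. by move=> cg ch x; apply: cvgD; [exact: cg | exact: ch]. Qed.

Lemma continuous_const (c : R) : continuous (fun _ : R => c).
Proof. by move=> x; exact: cvg_cst. Qed.

Lemma continuous_wloss pi (d : R -> R) : continuous d ->
  continuous (fun x => wloss pi (d x) x).
Proof.
move=> cd; apply: continuous_pmean => m; apply: continuous_funM.
  exact: continuous_exp_mean_pdf.
have c : continuous (fun x => d x - ln m).
  by apply: continuous_funD => //; exact: continuous_const.
by under eq_fun do rewrite expr2; exact: continuous_funM.
Qed.

Lemma exp_mean_pdf_le1 (m x : R) : 1 <= m -> 0 <= x -> exp_mean_pdf m x <= 1.
Proof.
move=> m1 x0; have m0 : 0 < m by lra.
rewrite /exp_mean_pdf -[leRHS]mulr1 ler_pM ?expR_ge0 ?invr_ge0 ?(ltW m0) ?invf_le1//.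
by rewrite expR_le1 oppr_le0 divr_ge0 ?(ltW m0).
Qed.

Lemma exp_mean_pdf_lb (M m x T : R) : 1 <= m -> m <= M -> 0 <= x -> x <= T ->
  M^-1 * expR (- T) <= exp_mean_pdf m x.
Proof.
move=> m1 mM x0 xT; have m0 : 0 < m by lra.
have M0 : 0 < M by lra.
rewrite /exp_mean_pdf ler_pM ?expR_ge0 ?invr_ge0 ?(ltW M0) ?lef_pV2 ?posrE//.
rewrite ler_expR lerN2 ler_pdivrMr//.
have T0 : 0 <= T by exact: le_trans xT.
by apply: (le_trans xT); rewrite ler_peMr.
Qed.

Section Valid.
Variables (M : R) (pi : seq (R * R)).
Hypothesis pi_prior : is_prior M pi.

Lemma marginal_lb (x T : R) : 0 <= x -> x <= T -> M^-1 * expR (- T) <= marginal pi x.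
Proof.
move=> x0 xT; rewrite -(pmean_cst M pi (M^-1 * _) pi_prior).
by apply: (le_pmean M) => // m m1 mM; exact: exp_mean_pdf_lb.
Qed.

Lemma prior_gt0 : exists2 q, q \in pi & 0 < q.1 /\ 1 <= q.2 <= M.
Proof.
have [wf w1] := pi_prior.
have [[q qpi q0]|no] := pselect (exists2 q, q \in pi & 0 < q.1).
  by exists q => //; have [_ -> ->] := wf _ qpi.
suff : (1 : R) = 0 by move=> h; have := @oner_neq0 R; rewrite h eqxx.
rewrite -w1 /pmean big_seq big1// => q qpi; rewrite mulr1.
have [q0 _ _] := wf _ qpi; apply/eqP; move: q0; rewrite le_eqVlt => /predU1P[<-//|q0].
by exfalso; apply: no; exists q.
Qed.

(** Positivity at every real [x], including negative ones that [marginal_lb] does not cover, makes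
    the Bayes rule continuous on the whole line. *)
Lemma marginal_gt0 x : 0 < marginal pi x.
Proof.
have [wf _] := pi_prior.
have [q qpi [q0 /andP[q1 qM]]] := prior_gt0.
rewrite /marginal /pmean (big_rem q qpi) /=; apply: ltr_pwDl.
  by apply: mulr_gt0 => //; apply: exp_mean_pdf_gt0; exact: lt_le_trans q1.
rewrite big_seq; apply: sumr_ge0 => r /mem_rem /wf[r0 r1 _].
by apply: mulr_ge0 => //; apply: exp_mean_pdf_ge0; exact: lt_le_trans r1.
Qed.

Lemma continuous_bayes_est : continuous (bayes_est pi).
Proof.
apply: continuous_funM.
  apply: continuous_pmean => m; apply: continuous_funM; first exact: continuous_const.
  exact: continuous_exp_mean_pdf.
move=> x; apply: cvgV; first by rewrite gt_eqF// marginal_gt0.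
exact: (continuous_pmean pi exp_mean_pdf continuous_exp_mean_pdf).
Qed.

Lemma bayes_est_itv x : 0 <= bayes_est pi x <= ln M.
Proof.
rewrite /bayes_est divr_ge0 ?(ltW (marginal_gt0 x))//=; last first.
  rewrite -(pmean_cst M pi 0 pi_prior); apply: (le_pmean M) => // m m1 mM.
  by rewrite mulr_ge0 ?ln_ge0// exp_mean_pdf_ge0//; lra.
rewrite ler_pdivrMr ?marginal_gt0// /marginal -pmeanZ.
apply: (le_pmean M) => // m m1 mM.
by rewrite ler_wpM2r ?exp_mean_pdf_ge0 ?ler_ln ?posrE//; lra.
Qed.

(** As a function of [d], the loss is a quadratic with leading coefficient [marginal pi x], and the
    posterior mean is its vertex. *)
Lemma wloss_decomp d x : wloss pi d x =
  wloss pi (bayes_est pi x) x + marginal pi x * (d - bayes_est pi x) ^+ 2.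
Proof.
have quad e : wloss pi e x = e ^+ 2 * marginal pi x +
    ((- 2 * e) * pmean pi (fun m => ln m * exp_mean_pdf m x) +
    pmean pi (fun m => ln m ^+ 2 * exp_mean_pdf m x)).
  rewrite -!pmeanZ -!pmeanD; apply: eq_bigr => q _ /=; congr (_ * _); ring.
have := marginal_gt0 x; rewrite !quad /bayes_est => m0; field; lra.
Qed.

Lemma wloss_bayes_le d x : wloss pi (bayes_est pi x) x <= wloss pi d x.
Proof.
by rewrite (wloss_decomp d) lerDl mulr_ge0 ?sqr_ge0// ltW// marginal_gt0.
Qed.

Lemma wloss_ge0 d x : 0 <= wloss pi d x.
Proof.
rewrite -(pmean_cst M pi 0 pi_prior); apply: (le_pmean M) => // m m1 mM.
by rewrite mulr_ge0 ?sqr_ge0// exp_mean_pdf_ge0//; lra.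
Qed.

Lemma continuous_wloss_bayes : continuous (fun x => wloss pi (bayes_est pi x) x).
Proof. exact/continuous_wloss/continuous_bayes_est. Qed.

(** The Bayes rule is compared with the constant decision [0]. *)
Lemma trunc_bayes_le (T : R) : 0 <= T -> trunc_bayes T pi <= ln M ^+ 2 * T.
Proof.
move=> T0; rewrite -trunc_int_cst//; apply: le_trunc_int.
- exact: continuous_wloss_bayes.
- exact: continuous_const.
- move=> x x0 _; apply: le_trans (wloss_bayes_le 0 x) _.
  rewrite -[leRHS](pmean_cst M pi _ pi_prior); apply: (le_pmean M) => // m m1 mM.
  rewrite sub0r sqrrN -[leRHS]mul1r ler_pM ?sqr_ge0 ?exp_mean_pdf_ge0 ?exp_mean_pdf_le1//; first lra.
  by rewrite lerXn2r ?nnegrE ?ln_ge0 ?ler_ln ?posrE//; lra.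
Qed.

End Valid.

(** Concavity: the loss is linear in the prior for a fixed rule, and the Bayes rule of the mixture
    is no better than the own Bayes rule of each component. *)
Lemma trunc_bayes_mixture (M T a : R) pi rho : is_prior M pi -> is_prior M rho ->
  0 <= a <= 1 ->
  a * trunc_bayes T pi + (1 - a) * trunc_bayes T rho <= trunc_bayes T (mixture a pi rho).
Proof.
move=> hpi hrho a01.
have cpi := continuous_wloss_bayes _ _ hpi.
have crho := continuous_wloss_bayes _ _ hrho.
have hmix := is_prior_mixture _ _ _ _ a01 hpi hrho.
rewrite /trunc_bayes -!trunc_intZ// -trunc_intD; last 2 first.
- by apply: continuous_funM => //; exact: continuous_const.
- by apply: continuous_funM => //; exact: continuous_const.
apply: le_trunc_int; last first.
- move=> x x0 xT; rewrite {3}/wloss pmean_mixture.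
  move/andP: a01 => [a0 a1].
  apply: lerD; apply: ler_wpM2l; rewrite ?subr_ge0//.
    exact: (wloss_bayes_le M).
  exact: (wloss_bayes_le M).
- exact: continuous_wloss_bayes hmix.
- by apply: continuous_funD; apply: continuous_funM => //; exact: continuous_const.
Qed.

Definition moment (p : R) pi : R := pmean pi (fun m => powR (ln m) p).

Definition game_value (T M p s : R) : R :=
  sup [set b | exists pi, [/\ is_prior M pi, moment p pi <= s & b = trunc_bayes T pi]].

Section Game.
Variables (T M p s : R).
Hypotheses (T0 : 0 <= T) (M1 : 1 <= M) (p0 : 0 < p) (s0 : 0 < s).

Lemma moment_dirac1 : moment p [:: (1, 1)] = 0.
Proof. by rewrite /moment pmean_dirac ln1 powR0// gt_eqF. Qed.

Let feasible : has_sup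
  [set b | exists pi, [/\ is_prior M pi, moment p pi <= s & b = trunc_bayes T pi]].
Proof.
split.
  exists (trunc_bayes T [:: (1, 1)]); exists [:: (1, 1)]; split=> //.
    exact: is_prior_dirac.
  by rewrite moment_dirac1 ltW.
by exists (ln M ^+ 2 * T) => _ [pi [hpi _ ->]]; exact: trunc_bayes_le.
Qed.

Lemma trunc_bayes_le_value pi : is_prior M pi -> moment p pi <= s ->
  trunc_bayes T pi <= game_value T M p s.
Proof. by move=> hpi mpi; apply: (ub_le_sup feasible.2); exists pi. Qed.

Lemma near_least_favorable (e : R) : 0 < e -> exists pi,
  [/\ is_prior M pi, moment p pi <= s & game_value T M p s - e < trunc_bayes T pi].
Proof.
by move=> e0; have [_ [pi [hpi mpi ->]] lt] := sup_adherent e0 feasible; exists pi.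
Qed.

Lemma moment_mixture (a : R) pi rho :
  moment p (mixture a pi rho) = a * moment p pi + (1 - a) * moment p rho.
Proof. exact: pmean_mixture. Qed.

(** The point mass at [1] has moment [0 < s] and serves as the strictly feasible point. *)
Lemma value_supergradient : exists2 l : R, 0 <= l & forall pi, is_prior M pi ->
  trunc_bayes T pi <= game_value T M p s + l * (moment p pi - s).
Proof.
apply: (supergradient _ (is_prior M) (trunc_bayes T) (moment p) s _ [:: (1, 1)]).
- move=> pi rho a hpi hrho a01; exists (mixture a pi rho); split.
  + exact: is_prior_mixture.
  + exact: moment_mixture.
  + exact: (trunc_bayes_mixture M).
- exact: trunc_bayes_le_value.
- exact: is_prior_dirac.
- by rewrite moment_dirac1.
Qed.

(* The Bayes rule of a nearly least favorable prior [pi] is nearly minimax: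
   perturbing [pi] to (1 - t) pi + t dirac_m moves the Bayes rule by O(t), so
   its excess risk under the perturbed prior is only O(t^2). *)
Lemma truncated_minimax (e : R) : 0 < e -> exists (delta : R -> R) (l : R),
  [/\ continuous delta, forall x, 0 <= delta x <= ln M, 0 <= l &
  forall m, 1 <= m -> m <= M ->
    trunc_int T (fun x => exp_mean_pdf m x * (delta x - ln m) ^+ 2) <=
    game_value T M p s + e + l * (powR (ln m) p - s)].
Proof.
move=> e0; have [l l0 hl] := value_supergradient.
set V := game_value T M p s in hl *.
(* [t ^+ 2 * K] will bound the excess risk on [[0, T]] of the rule of [pi] under the perturbed
   prior. *)
pose K := 2 * ln M ^+ 2 * M * expR T * T.
have M0 : 0 <= M by exact: le_trans ler01 M1.
have C0 : 0 <= 2 * ln M ^+ 2 * M * expR T.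
  apply: mulr_ge0; last exact: expR_ge0.
  by apply: mulr_ge0 => //; apply: mulr_ge0 => //; exact: sqr_ge0.
have K0 : 0 <= K by exact: mulr_ge0.
(* The bound by [2^-1] keeps at least half of the weight on [pi]; the other one makes the excess
   risk, once divided by [t], at most [e / 2]. *)
pose t := Num.min 2^-1 (e / (2 * (K + 1))).
have t0 : 0 < t by rewrite /t lt_min invr_gt0 ltr0n/= divr_gt0//; lra.
have t2 : t <= 2^-1 by rewrite /t ge_min lexx.
have tK : t * K <= e / 2.
  have : t <= e / (2 * (K + 1)) by rewrite /t ge_min lexx orbT.
  by rewrite ler_pdivlMr//; lra.
(* The precision carries a factor [t] because the final inequality is divided by [t]. *)
have [pi [hpi mpi Bpi]] := near_least_favorable (t * (e / 2)) ltac:(nra).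
pose d := bayes_est pi; have cd : continuous d by exact: continuous_bayes_est hpi.
exists d, l; split=> //; first exact: bayes_est_itv hpi.
move=> m m1 mM; set r := trunc_int _ _.
pose rho := mixture (1 - t) pi [:: (1, m)].
have hm := is_prior_dirac M m m1 mM.
have hrho : is_prior M rho by apply: is_prior_mixture => //; lra.
have cr : continuous (fun x => exp_mean_pdf m x * (d x - ln m) ^+ 2).
  have /(continuous_wloss [:: (1, m)]) := cd.
  by under eq_fun do rewrite /wloss pmean_dirac.
have split1 : trunc_int T (fun x => wloss rho (d x) x) =
    (1 - t) * trunc_bayes T pi + t * r.
  rewrite -trunc_intZ; last exact: continuous_wloss_bayes hpi.
  rewrite -trunc_intZ// -trunc_intD.
  - congr trunc_int; apply/funext => x.
    by rewrite {1}/wloss pmean_mixture pmean_dirac; congr (_ + _ * _); lra.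
  - by apply: continuous_funM; [exact: continuous_const | exact: continuous_wloss_bayes hpi].
  - by apply: continuous_funM => //; exact: continuous_const.
have excess x : 0 <= x -> x <= T ->
    wloss rho (d x) x <= wloss rho (bayes_est rho x) x +
      t ^+ 2 * (2 * ln M ^+ 2 * M * expR T).
  move=> x0 xT; rewrite (wloss_decomp M rho hrho (d x)) lerD2l.
  have g0 := marginal_gt0 _ _ hrho x; have f0 := marginal_gt0 _ _ hpi x.
  (* Multiplied by the marginal of [rho], the difference of the two rules loses its [pi] part, since
     [d] is the posterior mean under [pi]. What remains is of order [t], hence the excess is of
     order [t ^+ 2]. *)
  have shift : marginal rho x * (d x - bayes_est rho x) =
      t * exp_mean_pdf m x * (d x - ln m).
    have post pi' : 0 < marginal pi' x -> pmean pi' (fun m => ln m * exp_mean_pdf m x) =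
        marginal pi' x * bayes_est pi' x.
      by move=> h; rewrite /bayes_est mulrC divfK// gt_eqF.
    rewrite mulrBr -(post _ g0) pmean_mixture (post _ f0) pmean_dirac -/d.
    rewrite /marginal !pmean_mixture !pmean_dirac.
    ring.
  have -> : marginal rho x * (d x - bayes_est rho x) ^+ 2 =
      t ^+ 2 * (exp_mean_pdf m x ^+ 2 * (d x - ln m) ^+ 2 / marginal rho x).
    have : (marginal rho x * (d x - bayes_est rho x)) ^+ 2 / marginal rho x =
      marginal rho x * (d x - bayes_est rho x) ^+ 2 by field; lra.
    by move=> <-; rewrite shift; field; lra.
  rewrite ler_wpM2l ?sqr_ge0// ler_pdivrMr//.
  have f2 : exp_mean_pdf m x ^+ 2 <= 1.
    by rewrite expr_le1// ?exp_mean_pdf_le1// exp_mean_pdf_ge0//; lra.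
  have l2 : (d x - ln m) ^+ 2 <= ln M ^+ 2.
    have /andP[d0 dM] : 0 <= d x <= ln M by exact: bayes_est_itv hpi x.
    have lm0 : 0 <= ln m by rewrite ln_ge0.
    have lmM : ln m <= ln M by rewrite ler_ln ?posrE//; lra.
    by rewrite -ler_sqrt ?sqr_ge0// !sqrtr_sqr ler_norml !ger0_norm; lra.
  have glb : 2^-1 * (M^-1 * expR (- T)) <= marginal rho x.
    rewrite /marginal pmean_mixture pmean_dirac.
    have := marginal_lb _ _ hpi x T x0 xT.
    have fm0 : 0 <= exp_mean_pdf m x by rewrite exp_mean_pdf_ge0//; lra.
    have : 0 < M^-1 * expR (- T) by rewrite mulr_gt0 ?expR_gt0// invr_gt0; lra.
    rewrite /marginal; nra.
  apply: (@le_trans _ _ (ln M ^+ 2)).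
    by rewrite -[leRHS]mul1r ler_pM ?sqr_ge0.
  apply: (@le_trans _ _ (2 * ln M ^+ 2 * M * expR T * (2^-1 * (M^-1 * expR (- T))))).
    have -> : expR (- T) = (expR T)^-1 by rewrite expRN.
    have eT := expR_gt0 T.
    by rewrite le_eqVlt; apply/orP; left; apply/eqP; field; lra.
  by rewrite ler_wpM2l.
have upper : trunc_int T (fun x => wloss rho (d x) x) <=
    trunc_bayes T rho + t ^+ 2 * K.
  have -> : t ^+ 2 * K = trunc_int T (fun=> t ^+ 2 * (2 * ln M ^+ 2 * M * expR T)).
    by rewrite trunc_int_cst// /K; ring.
  rewrite /trunc_bayes -trunc_intD; last 2 first.
  - exact: continuous_wloss_bayes hrho.
  - exact: continuous_const.
  apply: le_trunc_int => //; first exact: continuous_wloss.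
  apply: continuous_funD; [exact: continuous_wloss_bayes hrho | exact: continuous_const].
have := hl rho hrho.
rewrite moment_mixture {2}/moment pmean_dirac => Brho.
rewrite split1 in upper.
(* The share of [pi] in the moment is at most [(1 - t) * s], so only the excess moment of the point
   mass at [m] is charged. *)
have h1 : l * ((1 - t) * moment p pi + (1 - (1 - t)) * powR (ln m) p - s) <=
    t * (l * (powR (ln m) p - s)).
  have : 0 <= l * ((1 - t) * (s - moment p pi)) by rewrite !mulr_ge0//; lra.
  nra.
have h2 : t * r <= t * (V + e + l * (powR (ln m) p - s)).
  have h3 : t * (t * K) <= t * (e / 2) by rewrite ler_pM2l.
  have h4 : (1 - t) * (V - t * (e / 2)) <= (1 - t) * trunc_bayes T pi.
    by rewrite ler_pM2l ?ltW//; lra.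
  have h5 : 0 <= t * (t * (e / 2)) by rewrite !mulr_ge0//; lra.
  move: upper h1 h3 h4 h5 Brho; rewrite expr2; set LL := l * (powR _ _ - s); lra.
by rewrite ler_pM2l in h2.
Qed.

End Game.

End TruncatedGame.

(** * Product priors *)

Lemma behead_cons_tuple (T : Type) n (x : T) (t : n.-tuple T) :
  [tuple of behead [tuple of x :: t]] = t.
Proof. exact: val_inj. Qed.

Section ProductPrior.
Context {R : realType} (k : nat) (w m : 'I_k -> R) (M : R).
Local Notation leb := (@lebesgue_measure R).
Local Notation halfline := (`[0%R, +oo[%classic : set R).

(** Expectation when the [n] means are drawn independently from the atoms [m] with weights [w]. This
    version takes possibly infinite risks; [prior_meanR] serves for signed real quantities such as
    centred sums. *)
Fixpoint prior_mean (n : nat) : (n.-tuple R -> \bar R) -> \bar R :=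
  match n with
  | 0 => fun F => F [tuple]
  | n'.+1 => fun F =>
      (\sum_(i < k) (w i)%:E * prior_mean n' (fun t => F [tuple of m i :: t]))%E
  end.

Fixpoint prior_meanR (n : nat) : (n.-tuple R -> R) -> R :=
  match n with
  | 0 => fun Q => Q [tuple]
  | n'.+1 => fun Q =>
      \sum_(i < k) w i * prior_meanR n' (fun t => Q [tuple of m i :: t])
  end.

(** Contains the support of the product prior. Risks are known to be nonnegative only for positive
    means, so comparisons under [prior_mean] are required on this set alone. *)
Definition box (n : nat) (mu : n.-tuple R) := forall i, 1 <= tnth mu i <= M.

Hypotheses (w_ge0 : forall i, 0 <= w i) (w_sum : \sum_(i < k) w i = 1)
  (m_itv : forall i, 1 <= m i <= M).

Lemma box_nil : box 0 [tuple].
Proof. by case. Qed.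

Lemma box_cons n i (t : n.-tuple R) : box n t -> box n.+1 [tuple of m i :: t].
Proof.
move=> bt j; case: (unliftP ord0 j) => [j'|] ->; by rewrite ?tnthS ?tnth0.
Qed.

Lemma box_gt0 n (mu : n.-tuple R) : box n mu -> forall i, 0 < tnth mu i.
Proof. by move=> bmu i; have /andP[h _] := bmu i; exact: lt_le_trans h. Qed.

Lemma prior_mean_ge0 n F : (forall mu, box n mu -> 0 <= F mu)%E ->
  (0 <= prior_mean n F)%E.
Proof.
elim: n F => [|n IH] F F0 /=; first exact/F0/box_nil.
apply: sume_ge0 => i _; apply: mule_ge0; first by rewrite lee_fin.
by apply: IH => t bt; apply: F0; exact: box_cons.
Qed.

Lemma le_prior_mean n F G : (forall mu, box n mu -> F mu <= G mu)%E ->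
  (prior_mean n F <= prior_mean n G)%E.
Proof.
elim: n F G => [|n IH] F G FG /=; first exact/FG/box_nil.
apply: lee_sum => i _; apply: lee_wpmul2l; first by rewrite lee_fin.
by apply: IH => t bt; apply: FG; exact: box_cons.
Qed.

Lemma eq_prior_mean n F G : (forall mu, box n mu -> F mu = G mu) ->
  prior_mean n F = prior_mean n G.
Proof.
by move=> FG; apply/eqP; rewrite eq_le !le_prior_mean// => mu bmu; rewrite FG.
Qed.

Lemma prior_mean_fin n (Q : n.-tuple R -> R) :
  prior_mean n (fun mu => (Q mu)%:E) = (prior_meanR n Q)%:E.
Proof.
elim: n Q => [//|n IH] Q /=; rewrite -sumEFin; apply: eq_bigr => i _.
by rewrite IH EFinM.
Qed.

Lemma prior_meanRD n (P Q : n.-tuple R -> R) :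
  prior_meanR n (fun mu => P mu + Q mu) = prior_meanR n P + prior_meanR n Q.
Proof.
elim: n P Q => [//|n IH] P Q /=; rewrite -big_split; apply: eq_bigr => i _.
by rewrite IH mulrDr.
Qed.

Lemma prior_meanRZ n (c : R) (Q : n.-tuple R -> R) :
  prior_meanR n (fun mu => c * Q mu) = c * prior_meanR n Q.
Proof.
elim: n Q => [//|n IH] Q /=; rewrite mulr_sumr; apply: eq_bigr => i _.
by rewrite IH mulrCA.
Qed.

Lemma prior_meanR_cst n (c : R) : prior_meanR n (fun=> c) = c.
Proof.
elim: n => [//|n IH] /=; under eq_bigr do rewrite IH.
by rewrite -mulr_suml w_sum mul1r.
Qed.

Lemma eq_prior_meanR n (P Q : n.-tuple R -> R) : P =1 Q ->
  prior_meanR n P = prior_meanR n Q.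
Proof. by move=> /funext ->. Qed.

Lemma prior_meanD n F G :
  (forall mu, box n mu -> 0 <= F mu)%E -> (forall mu, box n mu -> 0 <= G mu)%E ->
  prior_mean n (fun mu => F mu + G mu)%E = (prior_mean n F + prior_mean n G)%E.
Proof.
elim: n F G => [//|n IH] F G F0 G0 /=; rewrite -big_split; apply: eq_bigr => i _.
have F0' t : box n t -> (0 <= F [tuple of m i :: t])%E.
  by move=> bt; apply: F0; exact: box_cons.
have G0' t : box n t -> (0 <= G [tuple of m i :: t])%E.
  by move=> bt; apply: G0; exact: box_cons.
by rewrite IH// ge0_muleDr// prior_mean_ge0.
Qed.

Lemma prior_meanZ n (c : R) F :
  0 <= c -> (forall mu, box n mu -> 0 <= F mu)%E ->
  prior_mean n (fun mu => c%:E * F mu)%E = (c%:E * prior_mean n F)%E.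
Proof.
elim: n F => [//|n IH] F c0 F0 /=.
have F0' i t : box n t -> (0 <= F [tuple of m i :: t])%E.
  by move=> bt; apply: F0; exact: box_cons.
rewrite ge0_sume_distrr; last first.
  by move=> i _; rewrite mule_ge0 ?lee_fin//; apply: prior_mean_ge0 => t; exact: F0'.
by apply: eq_bigr => i _; rewrite IH// 1?muleCA//; exact: F0'.
Qed.

Lemma prior_mean_sum n (I : Type) (s : seq I) (F : I -> n.-tuple R -> \bar R) :
  (forall j mu, box n mu -> 0 <= F j mu)%E ->
  prior_mean n (fun mu => \sum_(j <- s) F j mu)%E =
  (\sum_(j <- s) prior_mean n (F j))%E.
Proof.
move=> F0; elim: s => [|j s IH].
  rewrite big_nil; under eq_prior_mean do rewrite big_nil.
  by rewrite prior_mean_fin prior_meanR_cst.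
rewrite big_cons -IH -prior_meanD; [|exact: F0|]; last first.
  by move=> mu bmu; apply: sume_ge0 => i _; exact: F0.
by apply: eq_prior_mean => mu _; rewrite big_cons.
Qed.

Lemma measurable_prior_mean n (H : n.-tuple R -> R -> \bar R) :
  (forall mu, box n mu -> measurable_fun setT (H mu)) ->
  measurable_fun setT (fun x => prior_mean n (H^~ x)).
Proof.
elim: n H => [|n IH] H mH /=; first exact: (mH _ box_nil).
apply: emeasurable_sum => i; apply: measurable_funeM.
by apply: (IH (fun t => H [tuple of m i :: t])) => t bt; apply: mH; exact: box_cons.
Qed.

(** Tonelli for a finite prior: each induction step moves one finite sum through the integral. *)
Lemma prior_mean_integral n (a : R) (H : n.-tuple R -> R -> \bar R) : 0 < a ->
  (forall mu, box n mu -> measurable_fun setT (H mu)) ->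
  (forall mu x, box n mu -> 0 <= H mu x)%E ->
  prior_mean n (fun mu =>
    \int[leb]_(x in halfline) ((exp_mean_pdf a x)%:E * H mu x))%E =
  (\int[leb]_(x in halfline) ((exp_mean_pdf a x)%:E * prior_mean n (H^~ x)))%E.
Proof.
move=> a0; have f0 x : (0 <= (exp_mean_pdf a x)%:E)%E by rewrite lee_fin exp_mean_pdf_ge0.
elim: n H => [//|n IH] H mH H0 /=.
have mH' i t : box n t -> measurable_fun setT (H [tuple of m i :: t]).
  by move=> bt; apply: mH; exact: box_cons.
have H0' i t x : box n t -> (0 <= H [tuple of m i :: t] x)%E.
  by move=> bt; apply: H0; exact: box_cons.
have m0 i : measurable_fun halfline (fun x => (exp_mean_pdf a x)%:E *
    ((w i)%:E * prior_mean n (fun t => H [tuple of m i :: t] x)))%E.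
  apply: measurable_exp_integrand; apply: measurable_funeM.
  by apply: (measurable_prior_mean n (fun t => H [tuple of m i :: t])) => t; exact: mH'.
have p0 i x : (0 <= prior_mean n (fun t => H [tuple of m i :: t] x))%E.
  by apply: prior_mean_ge0 => t bt; exact: H0'.
transitivity (\int[leb]_(x in halfline) \sum_(i < k) ((exp_mean_pdf a x)%:E *
    ((w i)%:E * prior_mean n (fun t => H [tuple of m i :: t] x))))%E; last first.
  apply: eq_integral => x _; rewrite ge0_sume_distrr// => i _.
  by rewrite mule_ge0// lee_fin.
rewrite ge0_integral_sum//; last first.
  by move=> i x _; rewrite !mule_ge0// lee_fin.
apply: eq_bigr => i _.
rewrite (IH (fun t => H [tuple of m i :: t])); [|exact: mH'|by move=> t x; exact: H0'].
rewrite -ge0_integralZl ?lee_fin//; last first.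
- by move=> x _; exact: mule_ge0.
- apply: measurable_exp_integrand.
  by apply: (measurable_prior_mean n (fun t => H [tuple of m i :: t])) => t; exact: mH'.
by apply: eq_integral => x _; rewrite muleCA.
Qed.

Let pi : seq (R * R) := [seq (w i, m i) | i <- enum 'I_k].

Lemma pmean_indexed g : pmean pi g = \sum_(i < k) w i * g (m i).
Proof. by rewrite /pmean big_map big_enum. Qed.

Lemma is_prior_indexed : is_prior M pi.
Proof.
split; last by rewrite pmean_indexed -[RHS]w_sum; apply: eq_bigr => i _; rewrite mulr1.
by move=> q /mapP[i _ ->] /=; have /andP[m1 mM] := m_itv i.
Qed.

Variable T : R.

Lemma trunc_bayes_le_integral :
  ((trunc_bayes T pi)%:E <=
   \int[leb]_(x in halfline) (wloss pi (bayes_est pi x) x)%:E)%E.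
Proof.
have cB := continuous_wloss_bayes _ _ is_prior_indexed.
have iB := trunc_integrable T _ cB.
rewrite /trunc_bayes /trunc_int /Rintegral fineK; last exact: integrable_fin_num.
apply: ge0_subset_integral => //.
- by apply: measurable_funTS; apply/measurable_EFinP; exact: continuous_measurable_fun.
- by move=> x _; rewrite lee_fin; exact: wloss_ge0 is_prior_indexed _ _.
- by move=> x; rewrite /= !in_itv /= => /andP[-> _].
Qed.

(* Whatever the decision [d] uses besides the coordinate [x] at hand, its
   posterior loss at [x] is at least the minimal one. *)
Lemma head_bayes_bound n (mu : n.-tuple R) (d : n.+1.-tuple R -> R) :
  box n mu -> measurable_fun setT d ->
  ((trunc_bayes T pi)%:E <= \sum_(i < k) (w i)%:E *
    \int[leb]_(x in halfline) ((exp_mean_pdf (m i) x)%:E *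
      exp_expect n mu (fun t => ((d [tuple of x :: t] - ln (m i)) ^+ 2)%:E)))%E.
Proof.
move=> bmu md; have mu0 := box_gt0 _ _ bmu.
have mi0 i : 0 < m i by have /andP[h _] := m_itv i; exact: lt_le_trans h.
have hpi := is_prior_indexed.
pose S i (z : n.+1.-tuple R) : \bar R := ((d z - ln (m i)) ^+ 2)%:E.
have S0 i z : (0 <= S i z)%E by rewrite lee_fin sqr_ge0.
have mS i : measurable_fun setT (S i).
  apply/measurable_EFinP; apply: measurable_funX.
  by apply: measurable_funB => //; exact: measurable_cst.
have cons0 x : measurable_fun setT (fun t : n.-tuple R => [tuple of x :: t]).
  exact: measurable_cons.
have mSx i x : measurable_fun setT (fun t : n.-tuple R => S i [tuple of x :: t]).
  exact: measurableT_comp.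
have mE i : measurable_fun setT
    (fun x => exp_expect n mu (fun t => S i [tuple of x :: t])).
  have [|//] := measurable_exp_expect _ (measurableTypeR R) n mu
    (fun x t => S i [tuple of x :: t]) mu0 (fun x t => S0 i _).
  apply: (measurableT_comp (mS i)).
  by apply: measurable_cons; [exact: measurable_fst | exact: measurable_snd].
have E0 i x : (0 <= exp_expect n mu (fun t => S i [tuple of x :: t]))%E.
  exact: exp_expect_ge0.
have f0 i x : 0 <= exp_mean_pdf (m i) x by exact: exp_mean_pdf_ge0.
rewrite (_ : (\sum_(i < k) _)%E =
  (\int[leb]_(x in halfline) \sum_(i < k) ((w i)%:E * ((exp_mean_pdf (m i) x)%:E *
      exp_expect n mu (fun t => S i [tuple of x :: t]))))%E); last first.
  rewrite ge0_integral_sum//.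
  - apply: eq_bigr => i _; rewrite ge0_integralZl ?lee_fin//.
    + exact: measurable_exp_integrand.
    + by move=> x _; rewrite mule_ge0// lee_fin.
  - by move=> i; apply: measurable_funeM; exact: measurable_exp_integrand.
  - by move=> i x _; rewrite !mule_ge0// lee_fin.
apply: le_trans trunc_bayes_le_integral _; apply: ge0_le_integral_sup => x _.
  by rewrite lee_fin; exact: wloss_ge0 hpi _ _.
rewrite (_ : (\sum_(i < k) _)%E =
    exp_expect n mu (fun t => (wloss pi (d [tuple of x :: t]) x)%:E)).
  rewrite -(exp_expect_cst n mu _ mu0); last exact: wloss_ge0 hpi _ _.
  apply: le_exp_expect => //.
  - by move=> t; rewrite lee_fin; exact: wloss_ge0 hpi _ _.
  - rewrite /wloss; under eq_fun do rewrite pmean_indexed.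
    apply/measurable_EFinP; apply: measurable_sum => i.
    apply: measurable_funM => //; apply: measurable_funM => //.
    by have /measurable_EFinP := mSx i x.
  - by move=> t; rewrite lee_fin; exact: wloss_bayes_le hpi _ _.
have Z0 i : 0 <= w i * exp_mean_pdf (m i) x by exact: mulr_ge0.
transitivity (\sum_(i < k) exp_expect n mu
    (fun t => (w i * exp_mean_pdf (m i) x)%:E * S i [tuple of x :: t]))%E.
  by apply: eq_bigr => i _; rewrite exp_expectZ// EFinM muleA.
rewrite -exp_expect_sum//.
- apply: eq_exp_expect => t; rewrite /wloss pmean_indexed -sumEFin.
  by apply: eq_bigr => i _; rewrite -EFinM mulrA.
- by move=> i t; rewrite mule_ge0// lee_fin.
- by move=> i; exact: measurable_funeM.
Qed.

(** Induction on [n]. If [i] is not the first coordinate, the first mean and observation are frozen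
    and the claim is applied to the rest. If it is the first, the order of averaging is exchanged so
    that the tail [mu] is fixed, and [head_bayes_bound] applies. *)
Lemma coord_bayes_bound n (i : 'I_n) (d : n.-tuple R -> R) :
  measurable_fun setT d ->
  ((trunc_bayes T pi)%:E <= prior_mean n (fun mu =>
    exp_expect n mu (fun x => ((d x - ln (tnth mu i)) ^+ 2)%:E)))%E.
Proof.
have mi0 j : 0 < m j by have /andP[h _] := m_itv j; exact: lt_le_trans h.
have B0 : 0 <= trunc_bayes T pi.
  by apply: Rintegral_ge0 => x _; exact: wloss_ge0 is_prior_indexed _ _.
elim: n i d => [[] //|n IH] i d md.
have mD a : measurable_fun setT (fun z => ((d z - a) ^+ 2)%:E).
  apply/measurable_EFinP; apply: measurable_funX.
  by apply: measurable_funB => //; exact: measurable_cst.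
case: (unliftP ord0 i) => [j|] -> /=.
- have step l : ((trunc_bayes T pi)%:E <= prior_mean n (fun t =>
      \int[leb]_(x in halfline) ((exp_mean_pdf (m l) x)%:E *
      exp_expect n t (fun s => ((d [tuple of x :: s] - ln (tnth t j)) ^+ 2)%:E)))%E)%E.
    have mH mu : box n mu -> measurable_fun setT (fun x =>
        exp_expect n mu (fun s => ((d [tuple of x :: s] - ln (tnth mu j)) ^+ 2)%:E)) /\
        forall x, (0 <= exp_expect n mu
           (fun s => ((d [tuple of x :: s] - ln (tnth mu j)) ^+ 2)%:E))%E.
      move=> /box_gt0 mu0.
      apply: (measurable_exp_expect _ (measurableTypeR R) n mu
        (fun x s => ((d [tuple of x :: s] - ln (tnth mu j)) ^+ 2)%:E)) => //.
        by move=> x s; rewrite lee_fin sqr_ge0.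
      apply: (measurableT_comp (mD (ln (tnth mu j)))).
      by apply: measurable_cons; [exact: measurable_fst | exact: measurable_snd].
    rewrite (prior_mean_integral n (m l) (fun t x =>
      exp_expect n t (fun s => ((d [tuple of x :: s] - ln (tnth t j)) ^+ 2)%:E)))//.
    + rewrite -[leLHS]mule1 -(integral_exp_mean_pdf (m l))//.
      rewrite -ge0_integralZl ?lee_fin//; last 2 first.
      * by apply: measurable_funTS; apply/measurable_EFinP; exact: measurable_exp_mean_pdf.
      * by move=> x _; rewrite lee_fin exp_mean_pdf_ge0.
      apply: ge0_le_integral_sup => x _.
        by rewrite mule_ge0// lee_fin// exp_mean_pdf_ge0.
      rewrite muleC lee_wpmul2l ?lee_fin ?exp_mean_pdf_ge0//.
      by apply: (IH j (fun s => d [tuple of x :: s])); apply: measurableT_comp => //; exact: measurable_cons.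
    + by move=> mu /mH[].
    + by move=> mu x /mH[].
  apply: (@le_trans _ _ (\sum_(l < k) (w l)%:E * (trunc_bayes T pi)%:E)%E).
    rewrite (eq_bigr (fun l => (w l * trunc_bayes T pi)%:E))// sumEFin.
    by rewrite -mulr_suml w_sum mul1r.
  apply: lee_sum => l _; apply: lee_wpmul2l; first by rewrite lee_fin.
  apply: le_trans (step l) _; apply: le_prior_mean => t bt.
  by rewrite tnthS theadE behead_cons_tuple.
- have mH l mu : box n mu -> (0 <= \int[leb]_(x in halfline) ((exp_mean_pdf (m l) x)%:E *
      exp_expect n mu (fun s => ((d [tuple of x :: s] - ln (m l)) ^+ 2)%:E)))%E.
    move=> /box_gt0 mu0; apply: integral_ge0 => x _.
    rewrite mule_ge0 ?lee_fin ?exp_mean_pdf_ge0//; apply: exp_expect_ge0 => //.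
      by move=> s; rewrite lee_fin sqr_ge0.
    by apply: (measurableT_comp (mD _)); exact: measurable_cons.
  rewrite (eq_bigr (fun l => prior_mean n (fun mu => (w l)%:E *
     \int[leb]_(x in halfline) ((exp_mean_pdf (m l) x)%:E *
      exp_expect n mu (fun s => ((d [tuple of x :: s] - ln (m l)) ^+ 2)%:E)))%E)); last first.
    move=> l _; rewrite prior_meanZ//; last exact: mH.
    congr (_ * _)%E; apply: eq_prior_mean => t bt; by rewrite tnth0 theadE behead_cons_tuple.
  rewrite -prior_mean_sum; last first.
    by move=> l mu bmu; rewrite mule_ge0 ?lee_fin ?mH.
  rewrite -[leLHS](_ : prior_mean n (fun=> (trunc_bayes T pi)%:E) = _); last first.
    by rewrite prior_mean_fin prior_meanR_cst.
  by apply: le_prior_mean => mu bmu; exact: head_bayes_bound.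
Qed.

(** Variances of independent coordinates add up: the cross terms vanish because [X - c] is centred,
    and each square is at most [C ^+ 2]. *)
Lemma prior_variance n (X : R -> R) (c C : R) :
  \sum_(i < k) w i * X (m i) = c -> (forall i, `|X (m i) - c| <= C) ->
  prior_meanR n (fun mu => (\sum_(i < n) (X (tnth mu i) - c)) ^+ 2) <= n%:R * C ^+ 2.
Proof.
move=> meanX bX; elim: n => [|n IH] /=.
  by rewrite big_ord0 expr0n /= mul0r.
pose S (t : n.-tuple R) := \sum_(i < n) (X (tnth t i) - c).
have step l : prior_meanR n (fun t => (\sum_(i < n.+1)
    (X (tnth [tuple of m l :: t] i) - c)) ^+ 2) =
    (X (m l) - c) ^+ 2 + ((X (m l) - c) * (2 * prior_meanR n S) +
    prior_meanR n (fun t => S t ^+ 2)).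
  rewrite -prior_meanRZ -(prior_meanR_cst n ((X (m l) - c) ^+ 2)).
  rewrite -prior_meanRZ -prior_meanRD -prior_meanRD; apply: eq_prior_meanR => t.
  rewrite big_ord_recl tnth0 (eq_bigr (fun i => X (tnth t i) - c)).
    by rewrite -/(S t) /=; ring.
  by move=> i _; rewrite tnthS.
under eq_bigr do rewrite step mulrDr [X in _ + X]mulrDr.
rewrite !big_split /=.
have -> : \sum_(i < k) w i * ((X (m i) - c) * (2 * prior_meanR n S)) = 0.
  under eq_bigr do rewrite mulrA mulrBr.
  by rewrite -mulr_suml sumrB meanX -mulr_suml w_sum mul1r subrr mul0r.
rewrite add0r -mulr_suml w_sum mul1r -[n.+1%:R]nat1r mulrDl mul1r lerD//.
rewrite -[leRHS]mul1r -w_sum mulr_suml; apply: ler_sum => i _.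
by rewrite ler_wpM2l// -[leLHS]real_normK ?num_real// lerXn2r ?nnegrE//; exact: le_trans (bX i).
Qed.

End ProductPrior.

(** * Lower bound for the minimax risk *)

Section LowerBound.
Context {R : realType}.

(** Projection onto an interval containing the truth does not increase the error. Clamping caps the
    loss where the mean vector leaves [Mset]. *)
Lemma sqr_clamp_le (L y th : R) : 0 <= th -> th <= L ->
  (Num.min L (Num.max 0 y) - th) ^+ 2 <= (y - th) ^+ 2.
Proof.
move=> th0 thL; rewrite /Num.max /Num.min.
have [y0|y0] := ltP 0 y; have [yL|yL] := ltP L _; nra.
Qed.

Lemma clamp_itv (L y : R) : 0 <= L -> 0 <= Num.min L (Num.max 0 y) <= L.
Proof. by move=> L0; rewrite ge_min lexx le_min L0 le_max lexx. Qed.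

Lemma Mset_ones n (p eta : R) : 0 < p -> Mset n p eta [tuple of nseq n 1].
Proof.
move=> p0; split=> [i|]; first by rewrite tnth_nseq.
rewrite /logp_mean big1 ?mulr0 ?powR_ge0// => i _.
by rewrite tnth_nseq ln1 powR0// gt_eqF.
Qed.

Section Average.
Variables (k : nat) (w m : 'I_k -> R) (M T p eta : R) (n : nat).
Hypotheses (w_ge0 : forall i, 0 <= w i) (w_sum : \sum_(i < k) w i = 1)
  (m_itv : forall i, 1 <= m i <= M) (M1 : 1 <= M) (p0 : 0 < p) (n0 : (0 < n)%N).
Let c := \sum_(i < k) w i * powR (ln (m i)) p.
Hypothesis gap : c < powR eta p.
Let pi : seq (R * R) := [seq (w i, m i) | i <- enum 'I_k].
Let L := ln M.
Let C := powR L p.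

Lemma risk_ge0 (muhat : n.-tuple R -> n.-tuple R) (mu : n.-tuple R) : estimator n muhat -> (forall i, 0 < tnth mu i) ->
  (0 <= risk n muhat mu)%E /\
  measurable_fun setT (fun x => (logloss n (muhat x) mu)%:E).
Proof.
move=> [mh _] mu0.
have ml : measurable_fun setT (fun x => (logloss n (muhat x) mu)%:E).
  apply/measurable_EFinP; apply: measurable_funM; first exact: measurable_cst.
  apply: measurable_sum => i; apply: measurable_funX.
  apply: measurable_funB; last exact: measurable_cst.
  apply: (measurableT_comp (@measurable_ln R)).
  by move/measurable_fun_tnthP : mh => /(_ i).
split=> //; apply: exp_expect_ge0 => // x.
by rewrite lee_fin mulr_ge0 ?invr_ge0 ?sumr_ge0// => i _; rewrite sqr_ge0.
Qed.

(** The clamped estimator is averaged over the product prior. The average is at least the univariate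
    Bayes risk; inside [Mset] the integrand is at most the supremum of the risk, and outside it is
    at most [L ^+ 2], which Chebyshev's inequality makes negligible. *)
Lemma bayes_le_minimax (muhat : n.-tuple R -> n.-tuple R) : estimator n muhat ->
  ((trunc_bayes T pi)%:E <= ereal_sup [set risk n muhat mu | mu in Mset n p eta] +
    (L ^+ 2 * C ^+ 2 / (n%:R * (powR eta p - c) ^+ 2))%:E)%E.
Proof.
move=> hest; set S := ereal_sup _; have [mh _] := hest.
have nR : (0 : R) < n%:R by rewrite ltr0n.
have L0 : 0 <= L by rewrite ln_ge0.
have g0 : 0 < powR eta p - c by rewrite subr_gt0.
have S0 : (0 <= S)%E.
  apply: (@le_trans _ _ (risk n muhat [tuple of nseq n 1])).
    by apply: (risk_ge0 _ _ hest _).1 => i; rewrite tnth_nseq.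
  by apply: ereal_sup_ubound; exists [tuple of nseq n 1] => //; exact: Mset_ones.
pose d i x := Num.min L (Num.max 0 (ln (tnth (muhat x) i))).
have md i : measurable_fun setT (d i).
  apply: measurable_minr; first exact: measurable_cst.
  apply: measurable_maxr; first exact: measurable_cst.
  apply: (measurableT_comp (@measurable_ln R)).
  by move/measurable_fun_tnthP : mh => /(_ i).
pose sq i (mu : n.-tuple R) x : \bar R := ((d i x - ln (tnth mu i)) ^+ 2)%:E.
have sq0 i mu x : (0 <= sq i mu x)%E by rewrite lee_fin sqr_ge0.
have msq i mu : measurable_fun setT (sq i mu).
  apply/measurable_EFinP; apply: measurable_funX.
  by apply: measurable_funB => //; exact: measurable_cst.
have msum mu : measurable_fun setT (fun x => \sum_(i < n) sq i mu x)%E.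
  exact: emeasurable_sum.
pose loss (mu : n.-tuple R) x : \bar R := ((n%:R)^-1%:E * \sum_(i < n) sq i mu x)%E.
have loss0 mu x : (0 <= loss mu x)%E.
  by rewrite mule_ge0 ?lee_fin ?invr_ge0 ?sume_ge0.
have mloss mu : measurable_fun setT (loss mu) by exact: measurable_funeM.
have lossE mu x : loss mu x = (n%:R^-1 * \sum_(i < n) (d i x - ln (tnth mu i)) ^+ 2)%:E.
  by rewrite /loss /sq sumEFin EFinM.
pose G mu := exp_expect n mu (loss mu).
have Gge : ((trunc_bayes T pi)%:E <= prior_mean k w m n G)%E.
  have GE mu : box M n mu ->
      G mu = (n%:R^-1%:E * \sum_(i < n) exp_expect n mu (sq i mu))%E.
    move=> /box_gt0 mu0; rewrite /G exp_expectZ ?invr_ge0//; last first.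
      by move=> x; exact: sume_ge0.
    by rewrite exp_expect_sum.
  have E0 i mu : box M n mu -> (0 <= exp_expect n mu (sq i mu))%E.
    by move=> /box_gt0 mu0; exact: exp_expect_ge0.
  rewrite (eq_prior_mean _ _ _ _ w_ge0 m_itv n _ _ GE).
  rewrite (prior_meanZ _ _ _ _ w_ge0 m_itv) ?invr_ge0//; last first.
    by move=> mu bmu; apply: sume_ge0 => i _; exact: E0.
  rewrite (prior_mean_sum _ _ _ _ w_ge0 w_sum m_itv)//.
  apply: (@le_trans _ _ (n%:R^-1%:E * \sum_(i < n) (trunc_bayes T pi)%:E)%E).
    rewrite sumEFin -EFinM lee_fin sumr_const card_ord -[X in _ * X]mulr_natl.
    by rewrite mulrA mulVf ?mul1r// gt_eqF.
  apply: lee_wpmul2l; first by rewrite lee_fin invr_ge0.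
  apply: lee_sum => i _.
  exact: (coord_bayes_bound _ _ _ _ w_ge0 w_sum m_itv T n i (d i) (md i)).
apply: (le_trans Gge).
pose X (a : R) := powR (ln a) p.
pose dev (mu : n.-tuple R) := \sum_(i < n) (X (tnth mu i) - c).
(* Pointwise form of Chebyshev: outside [Mset] the deviation is at least [n%:R * (powR eta p - c)],
   so the normalized squared deviation dominates the indicator of this event. *)
have Gle mu : box M n mu ->
    (G mu <= S + (L ^+ 2 / (n%:R * (powR eta p - c)) ^+ 2 * dev mu ^+ 2)%:E)%E.
  move=> bmu; have mu0 := box_gt0 _ _ _ bmu.
  have lmu i : 0 <= ln (tnth mu i) <= L.
    have /andP[h1 hM] := bmu i.
    by rewrite ln_ge0//= ler_ln ?posrE//; exact: lt_le_trans hM.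
  have [good|bad] := leP (logp_mean n p mu) (powR eta p).
    apply: (@le_trans _ _ S); last first.
      by rewrite leeDl// lee_fin mulr_ge0 ?sqr_ge0// divr_ge0 ?sqr_ge0.
    apply: (@le_trans _ _ (risk n muhat mu)); last first.
      apply: ereal_sup_ubound; exists mu => //; split=> // i.
      by have /andP[] := bmu i.
    apply: le_exp_expect => //; first exact: (risk_ge0 _ _ hest mu0).2.
    move=> x; rewrite lossE lee_fin /logloss ler_wpM2l ?invr_ge0//.
    by apply: ler_sum => i _; have /andP[l0 lL] := lmu i; exact: sqr_clamp_le.
  apply: (@le_trans _ _ (L ^+ 2)%:E).
    rewrite -(exp_expect_cst n mu _ mu0 (sqr_ge0 L)).
    apply: le_exp_expect => //.
    move=> x; rewrite lossE lee_fin.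
    apply: (@le_trans _ _ (n%:R^-1 * \sum_(i < n) L ^+ 2)).
      rewrite ler_wpM2l ?invr_ge0//; apply: ler_sum => i _.
      have /andP[l0 lL] := lmu i.
      have /andP[d0 dL] := clamp_itv L (ln (tnth (muhat x) i)) L0.
      by rewrite -/(d i x) in d0 dL *; nra.
    by rewrite sumr_const card_ord -[X in _ * X]mulr_natl mulrA mulVf ?mul1r// gt_eqF.
  apply: (@le_trans _ _ (L ^+ 2 / (n%:R * (powR eta p - c)) ^+ 2 * dev mu ^+ 2)%:E); last first.
    by rewrite leeDr.
  rewrite lee_fin mulrAC ler_pdivlMr ?exprn_gt0 ?mulr_gt0//.
  rewrite ler_wpM2l ?sqr_ge0//.
  have devE : n%:R * (logp_mean n p mu - c) = dev mu.
    rewrite mulrBr /dev sumrB sumr_const card_ord [n%:R * c]mulr_natl /logp_mean.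
    by rewrite mulVKf// gt_eqF.
  have h : n%:R * (powR eta p - c) <= dev mu.
    by rewrite -devE ler_pM2l// lerD2r ltW.
  have h0 : 0 <= n%:R * (powR eta p - c) by rewrite mulr_ge0// ltW.
  by rewrite lerXn2r// nnegrE; exact: le_trans h.
apply: (le_trans (le_prior_mean _ _ _ _ w_ge0 m_itv _ _ _ Gle)).
(* An infinite supremum makes the claim trivial; otherwise everything is real and the variance bound
   applies. *)
case: S S0 {Gle} => [r r0|_|//]; last by rewrite addye ?leey.
under eq_fun do rewrite -EFinD.
rewrite prior_mean_fin lee_fin.
rewrite prior_meanRD prior_meanR_cst// prior_meanRZ lerD2l.
have C0 : 0 <= C by exact: powR_ge0.
have XC i : 0 <= X (m i) <= C.
  have /andP[m1 mM] := m_itv i.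
  rewrite powR_ge0 /= ge0_ler_powR ?nnegrE ?ln_ge0 ?(ltW p0)//.
  by rewrite ler_ln ?posrE//; [exact: lt_le_trans m1|exact: lt_le_trans M1].
have cC : 0 <= c <= C.
  apply/andP; split.
    by apply: sumr_ge0 => i _; apply: mulr_ge0 => //; have /andP[] := XC i.
  rewrite -[leRHS]mul1r -w_sum mulr_suml; apply: ler_sum => i _.
  by apply: ler_wpM2l => //; have /andP[] := XC i.
have bX i : `|X (m i) - c| <= C.
  have /andP[x0 xC] := XC i; have /andP[c0' cC'] := cC.
  by rewrite ler_norml; apply/andP; split; lra.
have var := prior_variance k w m w_ge0 w_sum n X c C erefl bX.
apply: (@le_trans _ _ (L ^+ 2 / (n%:R * (powR eta p - c)) ^+ 2 * (n%:R * C ^+ 2))).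
  by rewrite ler_wpM2l// divr_ge0 ?sqr_ge0.
by rewrite le_eqVlt; apply/orP; left; apply/eqP; field; lra.
Qed.

End Average.

Lemma minimax_risk_lower (T M p eta e : R) : 0 <= T -> 1 <= M -> 0 < p ->
  0 < eta -> 0 < e -> exists N, forall n, (N <= n)%N ->
  ((game_value T M p (powR eta p) - e)%:E <= minimax_risk n p eta)%E.
Proof.
move=> T0 M1 p0 eta0 e0; have s0 : 0 < powR eta p by exact: powR_gt0.
set s := powR eta p in s0 *; set V := game_value _ _ _ _.
have e4 : 0 < e / 4 by lra.
have [pi [hpi mpi Bpi]] := near_least_favorable T M p s T0 M1 p0 s0 _ e4.
have b0 : 0 <= ln M ^+ 2 * T by rewrite mulr_ge0 ?sqr_ge0.
have Ble := trunc_bayes_le M pi hpi T T0.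
(* Weight moved to the point mass at [1]: it brings the moment strictly below [s] and costs at most
   [e / 4] of Bayes risk. *)
pose kap := Num.min 2^-1 (e / 4 / (ln M ^+ 2 * T + 1)).
have kap0 : 0 < kap by rewrite /kap lt_min invr_gt0 ltr0n /= divr_gt0//; lra.
have kap2 : kap <= 2^-1 by rewrite /kap ge_min lexx.
have kapB : kap * (ln M ^+ 2 * T + 1) <= e / 4.
  have : kap <= e / 4 / (ln M ^+ 2 * T + 1) by rewrite /kap ge_min lexx orbT.
  by rewrite ler_pdivlMr//; lra.
pose pi' := mixture (1 - kap) pi [:: (1, 1)].
have h1 : is_prior M [:: ((1 : R), (1 : R))] by exact: is_prior_dirac.
have a01 : 0 <= 1 - kap <= 1 by apply/andP; split; lra.
have hpi' : is_prior M pi' by exact: is_prior_mixture.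
have mpi' : moment p pi' < s.
  rewrite /pi' moment_mixture moment_dirac1// mulr0 addr0.
  have : (1 - kap) * moment p pi <= (1 - kap) * s by rewrite ler_wpM2l//; lra.
  nra.
have Bpi' : V - e / 2 <= trunc_bayes T pi'.
  have := trunc_bayes_mixture M T (1 - kap) pi [:: (1, 1)] hpi h1 a01.
  have B1 : 0 <= trunc_bayes T [:: ((1 : R), (1 : R))].
    by apply: Rintegral_ge0 => x _; exact: (wloss_ge0 M _ h1).
  have : 0 <= (1 - (1 - kap)) * trunc_bayes T [:: ((1 : R), (1 : R))].
    by rewrite mulr_ge0//; lra.
  have : kap * trunc_bayes T pi <= kap * (ln M ^+ 2 * T) by rewrite ler_pM2l.
  rewrite -/pi' -/V in Bpi *; lra.
pose k := size pi'; pose q i := tnth (in_tuple pi') i.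
pose w i := (q i).1; pose m i := (q i).2.
have [wf w1] := hpi'.
have wf' i : [/\ 0 <= w i, 1 <= m i & m i <= M] by apply: wf; exact: mem_tnth.
have w_ge0 i : 0 <= w i by have [] := wf' i.
have m_itv i : 1 <= m i <= M by have [_ -> ->] := wf' i.
have pmeanE g : pmean pi' g = \sum_(i < k) w i * g (m i).
  by rewrite /pmean big_tnth.
have w_sum : \sum_(i < k) w i = 1.
  by rewrite -[RHS]w1 pmeanE; apply: eq_bigr => i _; rewrite mulr1.
have pi'E : [seq (w i, m i) | i <- enum 'I_k] = pi'.
  rewrite -[RHS](map_tnth_enum (in_tuple pi')).
  by apply: eq_map => i; rewrite /w /m /q -surjective_pairing.
pose c := \sum_(i < k) w i * powR (ln (m i)) p.
have cs : c < s by rewrite /c -(pmeanE (fun a => powR (ln a) p)).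
(* The Chebyshev error is [K / n%:R]; it gets the remaining [e / 2] of the allowance. *)
pose K := ln M ^+ 2 * powR (ln M) p ^+ 2 / (s - c) ^+ 2.
have g0 : 0 < s - c by lra.
have K0 : 0 <= K by rewrite /K divr_ge0 ?sqr_ge0// mulr_ge0 ?sqr_ge0.
exists (Num.truncn (K / (e / 2))).+1 => n Nn.
have n0 : (0 < n)%N by exact: leq_trans Nn.
have nR : (0 : R) < n%:R by rewrite ltr0n.
have Kn : K / n%:R <= e / 2.
  rewrite ler_pdivrMr// mulrC -ler_pdivrMr; last lra.
  by apply: ltW; apply: (lt_le_trans (Num.Theory.truncnS_gt _)); rewrite ler_nat.
apply: le_ereal_inf_tmp => _ [muhat [hest ->]].
have := bayes_le_minimax k w m M T p eta n w_ge0 w_sum m_itv M1 p0 n0 cs muhat hest.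
rewrite pi'E.
have -> : ln M ^+ 2 * powR (ln M) p ^+ 2 / (n%:R * (powR eta p - c) ^+ 2) = K / n%:R.
  by rewrite /K -/s; field; lra.
move=> h; rewrite -leeBlDr// in h; apply: le_trans h.
by rewrite -EFinB lee_fin; lra.
Qed.

End LowerBound.

(** * Risk of the estimator [x] beyond the truncation level *)

Section LogTail.
Context {R : realType}.
Local Notation leb := (@lebesgue_measure R).
Local Notation halfline := (`[0%R, +oo[%classic : set R).

Definition logsq (m x : R) : R := exp_mean_pdf m x * (ln x - ln m) ^+ 2.

Lemma logsq_ge0 m x : 0 < m -> 0 <= logsq m x.
Proof. by move=> m0; rewrite mulr_ge0 ?sqr_ge0// exp_mean_pdf_ge0. Qed.

Lemma measurable_logsq m : measurable_fun setT (logsq m).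
Proof.
apply: measurable_funM; first exact: measurable_exp_mean_pdf.
apply: measurable_funX; apply: measurable_funB => //; exact: measurable_cst.
Qed.

Lemma expR_sqr_le (y : R) : 0 <= y -> y ^+ 2 <= 2 * expR y.
Proof.
move=> y0; have := expR_ge1Dxn 1 y0.
have -> : (2`!)%:R = 2 :> R by [].
lra.
Qed.

Lemma expR_cube_le (y : R) : 0 <= y -> y ^+ 3 <= 6 * expR y.
Proof.
move=> y0; have := expR_ge1Dxn 2 y0.
have -> : (3`!)%:R = 6 :> R by [].
lra.
Qed.

(* For [x >= m], [ln (x / m) <= x / m], whose square is absorbed by a fraction
   of the exponential. *)
Lemma logsq_le_pdf (m x : R) : 0 < m -> m <= x ->
  logsq m x <= 128 * expR (- (x / (2 * m))) * exp_mean_pdf (4 * m) x.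
Proof.
move=> m0 mx; have x0 : 0 < x by exact: lt_le_trans mx.
rewrite /logsq /exp_mean_pdf -ln_div ?posrE//.
set u := x / m; have u1 : 1 <= u by rewrite ler_pdivlMr// mul1r.
have u0 : 0 < u by exact: lt_le_trans u1.
have lu0 : 0 <= ln u by rewrite ln_ge0.
have lu : ln u <= u by rewrite ltW// ln_sublinear.
have sq : ln u ^+ 2 <= 32 * expR (u / 4).
  have := expR_sqr_le (u / 4) (ltac:(lra)).
  have : ln u ^+ 2 <= u ^+ 2 by rewrite lerXn2r ?nnegrE// ltW.
  nra.
have -> : x / (2 * m) = u / 2 by rewrite /u; field; lra.
have -> : x / (4 * m) = u / 4 by rewrite /u; field; lra.
have -> : 128 * expR (- (u / 2)) * ((4 * m)^-1 * expR (- (u / 4))) =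
    m^-1 * expR (- u) * (32 * expR (u / 4)).
  (* The exponent is split as [u / 2 + u / 4 + u / 4]: one quarter cancels the growth of the squared
     logarithm, the other belongs to the density of mean [4 * m]. *)
  have -> : expR (- u) = expR (- (u / 2)) * expR (- (u / 4)) * expR (- (u / 4)).
    by rewrite -!expRD; congr expR; lra.
  rewrite [expR (- (u / 4))]expRN; have := expR_gt0 (u / 4) => e0.
  by field; lra.
by rewrite ler_wpM2l// mulr_ge0 ?expR_ge0// invr_ge0 ltW.
Qed.

(** In [logsq_le_pdf] the free exponential factor is largest at [T], and the density of mean [4 * m]
    has mass at most one there. *)
Lemma integral_logsq_far (T m : R) : 0 < m -> 0 <= T -> m <= T ->
  (\int[leb]_(x in `]T, +oo[%classic) (logsq m x)%:E <=
   (128 * expR (- (T / (2 * m))))%:E)%E.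
Proof.
move=> m0 T0 mT; have m4 : 0 < 4 * m by lra.
set c := 128 * expR _; have c0 : 0 <= c by rewrite mulr_ge0 ?expR_ge0.
apply: (@le_trans _ _ (\int[leb]_(x in `]T, +oo[%classic)
    (c%:E * (exp_mean_pdf (4 * m) x)%:E))%E).
  apply: ge0_le_integral_sup => x /=; rewrite in_itv/= andbT => Tx.
    by rewrite lee_fin logsq_ge0.
  rewrite -EFinM lee_fin; apply: le_trans (logsq_le_pdf m x m0 _) _.
    by rewrite (le_trans mT)// ltW.
  rewrite ler_wpM2r ?exp_mean_pdf_ge0// ler_wpM2l// ler_expR lerN2.
  by rewrite ler_pM2r ?invr_gt0; lra.
have mpdf : measurable_fun setT (fun x => (exp_mean_pdf (4 * m) x)%:E).
  apply/measurable_EFinP; exact: measurable_exp_mean_pdf.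
rewrite ge0_integralZl ?lee_fin//; last 2 first.
- exact: measurable_funTS.
- by move=> x _; rewrite lee_fin exp_mean_pdf_ge0.
rewrite -[leRHS]mule1 lee_wpmul2l ?lee_fin//.
rewrite -(integral_exp_mean_pdf (4 * m) m4); apply: ge0_subset_integral => //.
- exact: measurable_funTS.
- by move=> x _; rewrite lee_fin exp_mean_pdf_ge0.
- by move=> x /=; rewrite !in_itv/= !andbT => Tx; rewrite ltW// (le_lt_trans T0).
Qed.

(** The exponential factor is at most one, and the remaining integrand has an explicit
    antiderivative. Keeping [a] positive avoids the singularity of the logarithm. *)
Lemma integral_logsq_near (a m : R) : 0 < a -> a < m ->
  (\int[leb]_(x in `[a, m]%classic) (logsq m x)%:E <= 2%:E)%E.
Proof.
move=> a0 am; have m0 : 0 < m by exact: lt_trans am.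
pose l : R -> R := (@ln R) + cst (- ln m).
pose g : R -> R := cst m^-1 * (l * l).
(* With [l = ln (x / m)], this is [x / m * (l ^+ 2 - 2 * l + 2)], equal to [2] at [x = m] and
   nonnegative at [a]. *)
pose F : R -> R := (@id R * cst m^-1) * ((l * l + cst (- 2) * l) + cst 2).
have dl (x : R) : 0 < x -> is_derive x 1 l (x^-1 + 0).
  by move=> x0; apply: is_deriveD; exact: is_derive1_ln.
have dF (x : R) : 0 < x -> is_derive x 1 F (g x).
  move=> x0; have dlx := dl x x0.
  have d1 := is_deriveM (is_derive_id x (1 : R)) (is_derive_cst (m^-1) x (1 : R)).
  have d2 := is_deriveD (is_deriveM dlx dlx)
    (is_deriveM (is_derive_cst (- 2 : R) x (1 : R)) dlx).
  have d3 := is_deriveD d2 (is_derive_cst (2 : R) x (1 : R)).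
  have d4 := is_deriveM d1 d3.
  apply: is_derive_eq d4 _.
  change (x * m^-1 * (l x * (x^-1 + 0) + l x * (x^-1 + 0) +
    (- 2 * (x^-1 + 0) + l x * 0) + 0) +
    (l x * l x + - 2 * l x + 2) * (x * 0 + m^-1 * 1) = m^-1 * (l x * l x)).
  by move: (l x) => lx; field; apply/andP; split; rewrite gt_eqF.
have cont (h : R -> R) (x dh : R) : is_derive x 1 h dh -> {for x, continuous h}.
  by move=> hd; apply: differentiable_continuous; apply/derivable1_diffP.
have cl (x : R) : 0 < x -> {for x, continuous l} by move=> /dl /cont.
have cg : {within `[a, m]%classic, continuous g}.
  apply: continuous_in_subspaceT => x; rewrite inE/= in_itv/= => /andP[ax _].
  have x0 : 0 < x by exact: lt_le_trans ax.
  by apply: cvgM; [exact: cvg_cst | apply: cvgM; exact: cl].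
have FTC := @continuous_FTC2 R g F a m am cg.
have lrF : derivable_oo_LRcontinuous F a m.
  split.
  - move=> x; rewrite in_itv/= => /andP[ax _].
    by have [] := dF x (lt_trans a0 ax).
  - by apply: cvg_at_right_filter; exact: (cont F a _ (dF a a0)).
  - by apply: cvg_at_left_filter; exact: (cont F m _ (dF m m0)).
have F'g : {in `]a, m[, derive1 F =1 g}.
  move=> x; rewrite in_itv/= => /andP[ax _].
  by rewrite derive1E; have [_ ->] := dF x (lt_trans a0 ax).
apply: (@le_trans _ _ (\int[leb]_(x in `[a, m]%classic) (g x)%:E)%E).
  apply: ge0_le_integral_sup => x /=; rewrite in_itv/= => /andP[ax _].
    by rewrite lee_fin logsq_ge0.
  rewrite lee_fin /logsq /exp_mean_pdf.
  change (m^-1 * expR (- (x / m)) * (ln x - ln m) ^+ 2 <= m^-1 * (l x * l x)).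
  rewrite -mulrA ler_wpM2l ?invr_ge0 ?(ltW m0)// -expr2 -[leRHS]mul1r.
  rewrite ler_wpM2r ?sqr_ge0// expR_le1 oppr_le0 divr_ge0 ?(ltW m0)//.
  by rewrite ltW// (lt_le_trans a0).
rewrite FTC// -EFinB lee_fin.
have FE x : F x = x * m^-1 * (l x * l x + - 2 * l x + 2) by [].
have lm : l m = 0 by change (ln m - ln m = 0); exact: subrr.
have -> : F m = 2 by rewrite FE lm; field; rewrite gt_eqF.
rewrite lerBlDr lerDl FE mulr_ge0// ?mulr_ge0 ?invr_ge0 ?ltW//.
have := sqr_ge0 (l a - 1); nra.
Qed.

(** A bound uniform in [m]: if [m] exceeds [T], the integral is split at [m] into a near part, at
    most [2], and a far part, at most [128]. *)
Lemma integral_logsq_tail (T m : R) : 1 <= T -> 0 < m ->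
  (\int[leb]_(x in `]T, +oo[%classic) (logsq m x)%:E <= 130%:E)%E.
Proof.
move=> T1 m0; have T0 : 0 <= T by exact: le_trans T1.
have far S : 0 <= S -> m <= S ->
    (\int[leb]_(x in `]S, +oo[%classic) (logsq m x)%:E <= 128%:E)%E.
  move=> S0 mS; apply: le_trans (integral_logsq_far S m m0 S0 mS) _.
  rewrite lee_fin -[leRHS]mulr1 ler_wpM2l// expR_le1 oppr_le0 divr_ge0//.
  by rewrite mulr_ge0// ltW.
have [mT|Tm] := leP m T.
  by apply: (le_trans (far T T0 mT)); rewrite lee_fin ler_nat.
have mls D : measurable_fun D (fun x => (logsq m x)%:E).
  by apply: measurable_funTS; apply/measurable_EFinP; exact: measurable_logsq.
have -> : (`]T, +oo[%classic : set R) = `]T, m]%classic `|` `]m, +oo[%classic.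
  by apply: itv_bndbnd_setU; rewrite bnd_simp// ltW.
rewrite ge0_integral_setU//.
- have -> : 130%:E = (2%:E + 128%:E : \bar R)%E by rewrite -EFinD -natrD.
  apply: leeD; last exact: far (ltW m0) (lexx m).
  apply: le_trans (integral_logsq_near T m (lt_le_trans ltr01 T1) Tm).
  apply: ge0_subset_integral => //.
  + exact: mls.
  + by move=> x _; rewrite lee_fin logsq_ge0.
  + by move=> x /=; rewrite !in_itv/= => /andP[/ltW -> ->].
- exact: mls.
- by move=> x _; rewrite lee_fin logsq_ge0.
- apply/disj_setPS => x [] /=; rewrite !in_itv/= andbT => /andP[_ xm].
  by rewrite ltNge xm.
Qed.

End LogTail.

(** * Upper bound for the minimax Bayes risk *)

Section UpperBound.
Context {R : realType}.
Local Notation leb := (@lebesgue_measure R).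
Local Notation halfline := (`[0%R, +oo[%classic : set R).

Lemma EFin_trunc_int (T : R) (h : R -> R) : continuous h ->
  (trunc_int T h)%:E = (\int[leb]_(x in `[0%R, T]%classic) (h x)%:E)%E.
Proof.
move=> ch; rewrite /trunc_int /Rintegral fineK//.
exact: integrable_fin_num (trunc_integrable T h ch).
Qed.

Lemma trunc_int_subset (S T : R) (h : R -> R) : continuous h ->
  (forall x, 0 <= h x) -> S <= T -> trunc_int S h <= trunc_int T h.
Proof.
move=> ch h0 ST; rewrite -lee_fin !EFin_trunc_int//.
apply: ge0_subset_integral => //.
- apply: measurable_funTS; apply/measurable_EFinP; exact: continuous_measurable_fun.
- by move=> x _; rewrite lee_fin.
- by move=> x /=; rewrite !in_itv/= => /andP[-> xS]; exact: le_trans ST.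
Qed.

(** A prior on the two means [1] and [2] works for all [T] and [M] at once: on [[0, 1]] both
    densities are bounded below, and no decision is close to both [0] and [ln 2]. *)
Lemma game_value_gt0 (p s : R) : 0 < p -> 0 < s -> exists2 v, 0 < v &
  forall T M, 1 <= T -> 2 <= M -> v <= game_value T M p s.
Proof.
move=> p0 s0; set l := @ln R 2; have l0 : 0 < l by rewrite ln_gt0// ltr1n.
have lp0 : 0 <= powR l p by exact: powR_ge0.
(* The weight of the mean [2], small enough for the moment [kap * powR l p] to be at most [s]. *)
pose kap := Num.min 2^-1 (s / (powR l p + 1)).
have kap0 : 0 < kap by rewrite /kap lt_min invr_gt0 ltr0n /= divr_gt0//; lra.
have kap2 : kap <= 2^-1 by rewrite /kap ge_min lexx.
have kaps : kap * (powR l p + 1) <= s.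
  have : kap <= s / (powR l p + 1) by rewrite /kap ge_min lexx orbT.
  by rewrite ler_pdivlMr//; lra.
pose f : R := 2^-1 * expR (- 1).
have f0 : 0 < f by rewrite mulr_gt0 ?expR_gt0// invr_gt0.
exists (kap * f * (l ^+ 2 / 2)).
  by apply: mulr_gt0; [exact: mulr_gt0 | rewrite divr_gt0// exprn_gt0].
move=> T M T1 M2; have T0 : 0 <= T by lra.
have M1 : 1 <= M by lra.
pose pi := mixture kap [:: (1, 2)] [:: (1, 1)] : seq (R * R).
have a01 : 0 <= kap <= 1 by apply/andP; split; lra.
have hpi (N : R) : 2 <= N -> is_prior N pi.
  by move=> N2; apply: is_prior_mixture => //; apply: is_prior_dirac; lra.
apply: (@le_trans _ _ (trunc_bayes T pi)); last first.
  apply: trunc_bayes_le_value => //; first exact: hpi.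
  rewrite /pi moment_mixture moment_dirac1// mulr0 addr0 /moment pmean_dirac -/l.
  by nra.
have cB := continuous_wloss_bayes _ _ (hpi M M2).
apply: (@le_trans _ _ (trunc_int 1 (fun x => wloss pi (bayes_est pi x) x))); last first.
  by apply: trunc_int_subset => // x; exact: wloss_ge0 (hpi M M2) _ _.
rewrite -[leLHS]mulr1 -(trunc_int_cst 1 (kap * f * (l ^+ 2 / 2)) ler01).
apply: le_trunc_int => //.
  exact: continuous_const.
move=> x x0 x1; set d := bayes_est pi x.
rewrite /wloss pmean_mixture !pmean_dirac ln1 -/l.
have f2 : f <= exp_mean_pdf 2 x by apply: exp_mean_pdf_lb => //; lra.
have f1 : f <= exp_mean_pdf 1 x by apply: exp_mean_pdf_lb => //; lra.
have h2 : kap * (f * (d - l) ^+ 2) <= kap * (exp_mean_pdf 2 x * (d - l) ^+ 2).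
  by rewrite ler_pM2l// ler_wpM2r ?sqr_ge0.
have h1 : kap * (f * (d - 0) ^+ 2) <= (1 - kap) * (exp_mean_pdf 1 x * (d - 0) ^+ 2).
  apply: ler_pM; [lra | by rewrite mulr_ge0 ?sqr_ge0// ltW | lra |].
  by rewrite ler_wpM2r ?sqr_ge0.
apply: le_trans (lerD h2 h1).
(* From [(d - l) ^+ 2 + d ^+ 2 = 2 * (d - l / 2) ^+ 2 + l ^+ 2 / 2]. *)
have : 0 <= kap * f * (d - l / 2) ^+ 2.
  by apply: mulr_ge0; [apply: mulr_ge0; exact: ltW | exact: sqr_ge0].
nra.
Qed.

Definition coord_risk (est : R -> R) (m : R) : \bar R :=
  (\int[leb]_(x in halfline) (exp_mean_pdf m x * (ln (est x) - ln m) ^+ 2)%:E)%E.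

Lemma coord_risk_split (T m : R) (delta : R -> R) : 0 < m -> 0 <= T ->
  continuous delta ->
  coord_risk (fun x => if x <= T then expR (delta x) else x) m =
  ((trunc_int T (fun x => exp_mean_pdf m x * (delta x - ln m) ^+ 2))%:E +
   \int[leb]_(x in `]T, +oo[%classic) (logsq m x)%:E)%E.
Proof.
move=> m0 T0 cd; set est := fun x => _.
have mest : measurable_fun setT est.
  apply: measurable_fun_ifT => //.
    by apply: measurable_fun_ler => //; exact: measurable_cst.
  apply: measurableT_comp => //; exact: continuous_measurable_fun.
have mf D : measurable_fun D
    (fun x => (exp_mean_pdf m x * (ln (est x) - ln m) ^+ 2)%:E).
  apply: measurable_funTS; apply/measurable_EFinP.
  apply: measurable_funM; first exact: measurable_exp_mean_pdf.
  apply: measurable_funX; apply: measurable_funB; last exact: measurable_cst.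
  exact: (measurableT_comp (@measurable_ln R)).
rewrite /coord_risk.
have -> : halfline = `[0, T]%classic `|` `]T, +oo[%classic.
  by apply: itv_bndbnd_setU; rewrite bnd_simp.
rewrite ge0_integral_setU//; last 3 first.
- exact: mf.
- by move=> x _; rewrite lee_fin mulr_ge0 ?sqr_ge0// exp_mean_pdf_ge0.
- apply/disj_setPS => x [] /=; rewrite !in_itv/= andbT => /andP[_ xT].
  by rewrite ltNge xT.
congr (_ + _)%E.
  rewrite EFin_trunc_int; last first.
    have /(continuous_wloss [:: (1, m)]) := cd.
    by under eq_fun do rewrite /wloss pmean_dirac.
  apply: eq_integral => x; rewrite inE/= in_itv/= => /andP[_ xT].
  by rewrite /est xT expRK.
apply: eq_integral => x; rewrite inE/= in_itv/= andbT => xT.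
by rewrite /est leNgt xT.
Qed.

(* The slack [kap * th ^ p] exceeds any constant once [m >= A].  Choosing [T] far
   beyond [A] makes the part of the risk beyond [T] negligible for [m <= A], and
   then [M] so large that [X <= T] is negligible for [m > M]. *)
Lemma univariate_estimator (p s e kap : R) : 0 < p -> 0 < s -> 0 < e -> 0 < kap ->
  exists (T M a b : R) (est : R -> R),
  [/\ 1 <= T /\ 2 <= M, measurable_fun setT est /\ (forall x, 0 < est x), 0 <= b,
   a + b * s <= game_value T M p s + e + kap * s &
   forall m, 1 <= m -> (coord_risk est m <= (a + b * powR (ln m) p)%:E)%E].
Proof.
move=> p0 s0 e0 kap0.
(* Beyond [A] the slack is at least [131]: [130] pays for the risk beyond [T], and [1] for the risk
   below [T] when [m > M]. *)
pose A : R := expR (powR (131 / kap) p^-1).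
have large m : A <= m -> 131 <= kap * powR (ln m) p.
  move=> Am; have A0 : 0 < A by exact: expR_gt0.
  have Alm : powR (131 / kap) p^-1 <= ln m.
    by rewrite -[leLHS]expRK ler_ln ?posrE//; exact: lt_le_trans Am.
  rewrite mulrC -ler_pdivrMr//.
  have -> : 131 / kap = powR (powR (131 / kap) p^-1) p.
    by rewrite -powRrM mulVf ?gt_eqF// powRr1// divr_ge0// ltW.
  by apply: ge0_ler_powR; rewrite ?nnegrE ?powR_ge0 ?(ltW p0)//; exact: le_trans (powR_ge0 _ _) Alm.
have A1 : 1 <= A by rewrite -expR0 ler_expR powR_ge0.
pose y : R := 256 / e + 1; have y1 : 1 <= y by rewrite lerDr divr_ge0// ltW.
have ey : 128 * expR (- y) <= e / 2.
  have h : 256 / e <= expR y by have := expR_ge1Dx y; rewrite /y; lra.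
  have E0 := expR_gt0 y; rewrite expRN ler_pdivrMr//.
  by move: h; rewrite ler_pdivrMr//; nra.
(* For [m <= A] this gives [T / (2 * m) >= y], so the far tail costs at most [e / 2]. *)
pose T := 2 * A * y; have AT : A <= T by rewrite /T; nra.
have T1 : 1 <= T by exact: le_trans AT.
have T0 : 0 <= T by exact: le_trans T1.
(* For [m > M] one has [6 * T <= ln m], so [ln m ^+ 2 * T] is at most [ln m ^+ 3 / 6], hence at most
   [m]; this bounds the risk on [[0, T]] by one. *)
pose M : R := expR (6 * T).
have MT : 1 + 6 * T <= M by exact: expR_ge1Dx.
have M1 : 1 <= M by lra.
have [d [l [cd ditv l0 hl]]] := truncated_minimax T M p s T0 M1 p0 s0 (e / 2) ltac:(lra).
set V := game_value T M p s in hl *.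
exists T, M, (V + e - l * s), (l + kap).
exists (fun x => if x <= T then expR (d x) else x); split.
- by split=> //; lra.
- split.
    apply: measurable_fun_ifT => //.
      by apply: measurable_fun_ler => //; exact: measurable_cst.
    by apply: measurableT_comp => //; exact: continuous_measurable_fun.
  move=> x /=; case: (leP x T) => [_|Tx]; first exact: expR_gt0.
  exact: le_lt_trans Tx.
- lra.
- rewrite -/V; lra.
move=> m m1; have m0 : 0 < m by exact: lt_le_trans m1.
have lm0 : 0 <= ln m by rewrite ln_ge0.
have th0 : 0 <= powR (ln m) p by exact: powR_ge0.
rewrite coord_risk_split//.
set r1 := trunc_int _ _.
have tail := integral_logsq_tail T m T1 m0.
suff [t [h1 h2]] : exists t, r1 + t <= V + e - l * s + (l + kap) * powR (ln m) p /\
    (\int[leb]_(x in `]T, +oo[%classic) (logsq m x)%:E <= t%:E)%E.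
  by apply: (le_trans (leeD (lexx _) h2)); rewrite -EFinD lee_fin.
have [mA|Am] := leP m A.
  exists (128 * expR (- (T / (2 * m)))); split; last first.
    by apply: integral_logsq_far => //; exact: le_trans AT.
  have mM : m <= M by apply: (le_trans mA); lra.
  have := hl m m1 mM; rewrite -/r1.
  have : 128 * expR (- (T / (2 * m))) <= e / 2.
    apply: le_trans ey; rewrite ler_wpM2l// ler_expR lerN2.
    by rewrite ler_pdivlMr /T; nra.
  have : 0 <= kap * powR (ln m) p by rewrite mulr_ge0// ltW.
  lra.
have lar := large m (ltW Am).
exists 130; split=> //.
have [mM|Mm] := leP m M.
  have := hl m m1 mM; rewrite -/r1; lra.
have r1le : r1 <= 1.
  have lM : 6 * T <= ln m.
    by rewrite -[leLHS]expRK ler_ln ?posrE ?expR_gt0// ltW.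
  have cube := expR_cube_le (ln m) lm0.
  rewrite lnK ?posrE// in cube.
  have sqT : ln m ^+ 2 * T <= m.
    have : ln m ^+ 2 * (6 * T) <= ln m ^+ 2 * ln m by rewrite ler_wpM2l ?sqr_ge0.
    move: cube; rewrite exprSr; lra.
  apply: (@le_trans _ _ (trunc_int T (fun=> m^-1 * ln m ^+ 2))); last first.
    by rewrite trunc_int_cst// -mulrA ler_pdivrMl// mulr1.
  apply: le_trunc_int; last first.
  - move=> x x0 xT; apply: ler_pM; rewrite ?sqr_ge0 ?exp_mean_pdf_ge0//.
      rewrite /exp_mean_pdf -[leRHS]mulr1 ler_wpM2l ?invr_ge0 ?(ltW m0)//.
      by rewrite expR_le1 oppr_le0 divr_ge0 ?(ltW m0).
    have /andP[d0 dM] := ditv x.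
    have dm : d x <= ln m.
      by apply: (le_trans dM); rewrite ler_ln ?posrE ?expR_gt0// ltW.
    nra.
  - exact: continuous_const.
  - have /(continuous_wloss [:: (1, m)]) := cd.
    by under eq_fun do rewrite /wloss pmean_dirac.
(* The bound of the minimax rule is nonnegative at [M] and nondecreasing in the mean, so it stays
   nonnegative for [m > M]; the slack then covers the whole risk. *)
have base : 0 <= V + e / 2 + l * (powR (ln m) p - s).
  have h := hl M M1 (lexx M).
  have h0 : 0 <= trunc_int T (fun x => exp_mean_pdf M x * (d x - ln M) ^+ 2).
    apply: Rintegral_ge0 => x _; rewrite mulr_ge0 ?sqr_ge0// exp_mean_pdf_ge0//.
    exact: expR_gt0.
  have lMm : l * powR (ln M) p <= l * powR (ln m) p.
    rewrite ler_wpM2l// ge0_ler_powR ?nnegrE ?(ltW p0) ?ln_ge0//.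
    by rewrite ler_ln ?posrE ?expR_gt0// ltW.
  lra.
lra.
Qed.

(** * Coordinatewise use of a univariate estimator *)

Section Coordinatewise.
Variables (n : nat) (est : R -> R) (p a b s : R).
Hypotheses (n0 : (0 < n)%N) (mest : measurable_fun setT est) (est0 : forall x, 0 < est x)
  (b0 : 0 <= b) (s0 : 0 <= s)
  (risk_le : forall m, 1 <= m -> (coord_risk est m <= (a + b * powR (ln m) p)%:E)%E).

Definition coordwise (x : n.-tuple R) : n.-tuple R := [tuple est (tnth x i) | i < n].

Lemma estimator_coordwise : estimator n coordwise.
Proof.
split=> [|x i]; last by rewrite tnth_mktuple.
apply/measurable_fun_tnthP => i.
rewrite (_ : _ \o _ = est \o (fun x => tnth x i)); last first.
  by apply/funext => x /=; rewrite tnth_mktuple.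
by apply: measurableT_comp => //; exact: measurable_tnth.
Qed.

Lemma risk_coordwise_le (mu : n.-tuple R) : ge1_set n mu ->
  (0 <= risk n coordwise mu)%E /\
  (risk n coordwise mu <= (a + b * logp_mean n p mu)%:E)%E.
Proof.
move=> mu1; have mu0 i : 0 < tnth mu i by exact: lt_le_trans (mu1 i).
split; first by have [] := risk_ge0 n _ _ estimator_coordwise mu0.
pose sq i (x : n.-tuple R) : \bar R := ((ln (est (tnth x i)) - ln (tnth mu i)) ^+ 2)%:E.
have sq0 i x : (0 <= sq i x)%E by rewrite lee_fin sqr_ge0.
have mh i : measurable_fun setT (fun u => (ln (est u) - ln (tnth mu i)) ^+ 2).
  apply: measurable_funX; apply: measurable_funB; last exact: measurable_cst.
  exact: (measurableT_comp (@measurable_ln R)).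
have msq i : measurable_fun setT (sq i).
  apply/measurable_EFinP; apply: (measurableT_comp (mh i)); exact: measurable_tnth.
have nR : (0 : R) < n%:R by rewrite ltr0n.
have -> : risk n coordwise mu =
    (n%:R^-1%:E * \sum_(i < n) coord_risk est (tnth mu i))%E.
  rewrite /risk (eq_exp_expect _ _ _ (fun x => n%:R^-1%:E * \sum_(i < n) sq i x)%E).
    rewrite exp_expectZ ?invr_ge0//.
    - rewrite exp_expect_sum//; congr (_ * _)%E; apply: eq_bigr => i _.
      rewrite /sq (exp_expect_coord n mu i
        (fun u => (ln (est u) - ln (tnth mu i)) ^+ 2))// => u.
      exact: sqr_ge0.
    - by move=> x; exact: sume_ge0.
    - exact: emeasurable_sum.
  move=> x; rewrite /sq sumEFin -EFinM; congr (_ * _)%:E.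
  by apply: eq_bigr => i _; rewrite tnth_mktuple.
apply: (@le_trans _ _ (n%:R^-1%:E * \sum_(i < n) (a + b * powR (ln (tnth mu i)) p)%:E)%E).
  by apply: lee_wpmul2l; [rewrite lee_fin invr_ge0 | apply: lee_sum => i _; exact: risk_le].
rewrite sumEFin -EFinM lee_fin big_split /= sumr_const card_ord -mulr_sumr.
rewrite mulrDr -[a *+ n]mulr_natl mulKf ?gt_eqF//.
by rewrite /logp_mean mulrCA.
Qed.

Lemma measurable_ge1_set : measurable (ge1_set n : set (n.-tuple R)).
Proof.
have -> : ge1_set n = \bigcap_(i in [set: 'I_n])
    ((fun mu : n.-tuple R => tnth mu i) @^-1` `[1, +oo[%classic).
  apply/seteqP; split=> mu /= h i; first by move=> _; rewrite /= in_itv/= h.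
  by have := h i I; rewrite /= in_itv/= andbT.
apply: fin_bigcap_measurable => // i _.
by rewrite -[X in measurable X]setTI; apply: measurable_tnth.
Qed.

Lemma measurable_logp_mean : measurable_fun setT (logp_mean n p).
Proof.
apply: measurable_funM; first exact: measurable_cst.
apply: measurable_sum => i.
apply: (measurableT_comp (f := fun u => powR u p) (measurable_powR p)).
apply: (measurableT_comp (@measurable_ln R)); exact: measurable_tnth.
Qed.

(** The risk bound is affine in [logp_mean] with slope [b >= 0], so integrating it involves the
    prior only through its moment. *)
Lemma bayes_risk_coordwise_le (pi : probability (n.-tuple R) R) :
  pi (ge1_set n) = 1%E ->
  (\int[pi]_(mu in ge1_set n) (logp_mean n p mu)%:E <= s%:E)%E ->
  (bayes_risk n pi coordwise <= (a + b * s)%:E)%E.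
Proof.
move=> pi1 mom; have mG := measurable_ge1_set.
have l0 mu : 0 <= logp_mean n p mu.
  by rewrite mulr_ge0 ?invr_ge0 ?sumr_ge0// => i _; exact: powR_ge0.
have il : pi.-integrable (ge1_set n) (EFin \o logp_mean n p).
  apply/integrableP; split.
    by apply: measurable_funTS; apply/measurable_EFinP; exact: measurable_logp_mean.
  apply: (@le_lt_trans _ _ s%:E); last exact: ltry.
  apply: le_trans mom; rewrite le_eqVlt; apply/orP; left; apply/eqP.
  by apply: eq_integral => mu _ /=; rewrite ger0_norm.
have ia : pi.-integrable (ge1_set n) (EFin \o cst a).
  exact: finite_measure_integrable_cst.
(* Comparing through suprema of simple functions avoids proving that the risk is measurable in
   [mu]. *)
apply: (@le_trans _ _ (\int[pi]_(mu in ge1_set n)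
    ((cst a mu)%:E + b%:E * (logp_mean n p mu)%:E))%E).
  apply: ge0_le_integral_sup => mu hmu; have [r0 rle] := risk_coordwise_le mu hmu => //.
rewrite integralD//; last exact: integrableZl.
have -> : (\int[pi]_(mu in ge1_set n) (cst a mu)%:E = a%:E)%E.
  transitivity (a%:E * pi (ge1_set n))%E; first exact: (integral_cst pi mG a%:E).
  by rewrite pi1 mule1.
rewrite integralZl// EFinD EFinM.
by apply: leeD => //; apply: lee_wpmul2l; rewrite ?lee_fin.
Qed.

Lemma minimax_bayes_coordwise_le (eta : R) : powR eta p = s ->
  (minimax_bayes_risk n p eta <= (a + b * s)%:E)%E.
Proof.
move=> etas.
apply: (@le_trans _ _ (ereal_sup [set r' | exists pi, admissible_prior n p eta pi /\
   r' = bayes_risk n pi coordwise])).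
  by apply: ereal_inf_lbound; exists coordwise; split=> //; exact: estimator_coordwise.
apply: ge_ereal_sup => _ [pi [[pi1 mom] ->]]; apply: bayes_risk_coordwise_le => //.
by rewrite -etas.
Qed.

End Coordinatewise.

(** Each mean vector in [Mset] yields an admissible Dirac prior, whose Bayes risk is at least the
    risk at that vector. *)
Lemma minimax_le_bayes (n : nat) (p eta : R) :
  (minimax_risk n p eta <= minimax_bayes_risk n p eta)%E.
Proof.
apply: le_ereal_inf_tmp => _ [muhat [hest ->]].
apply: (@le_trans _ _ (ereal_sup [set risk n muhat mu | mu in Mset n p eta])).
  by apply: ereal_inf_lbound; exists muhat.
apply: ge_ereal_sup => _ [mu [mu1 mup] <-].
have mG := measurable_ge1_set n.
have risk0 nu : ge1_set n nu -> (0 <= risk n muhat nu)%E.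
  by move=> h; have [] := risk_ge0 n _ nu hest (fun i => lt_le_trans ltr01 (h i)).
apply: (@le_trans _ _ (bayes_risk n (dirac mu : probability _ R) muhat)); last first.
  apply: ereal_sup_ubound; exists (dirac mu : probability _ R); split=> //; split.
    by rewrite /= diracE mem_set.
  rewrite integral_dirac//; last first.
    by apply: measurable_funTS; apply/measurable_EFinP; exact: measurable_logp_mean.
  by rewrite diracE mem_set// mul1e lee_fin.
have mmu : measurable [set mu].
  have -> : [set mu] = \bigcap_(i in [set: 'I_n])
      ((fun nu : n.-tuple R => tnth nu i) @^-1` [set tnth mu i]).
    apply/seteqP; split=> nu /=; first by move=> -> i _.
    by move=> h; apply: eq_from_tnth => i; exact: (h i I).
  apply: fin_bigcap_measurable => // i _.
  by rewrite -[X in measurable X]setTI; apply: measurable_tnth.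
(* The risk is replaced by its value at [mu] times the indicator of [[set mu]]: a measurable lower
   bound with the same value at [mu]. *)
apply: (@le_trans _ _ (\int[dirac mu]_(nu in ge1_set n)
    (risk n muhat mu * (\1_[set mu] nu)%:E))%E).
  rewrite integral_dirac//; last first.
    apply: measurable_funTS; apply: measurable_funeM; apply/measurable_EFinP.
    exact: measurable_indic.
  by rewrite diracE mem_set// mul1e indicE mem_set// mule1.
apply: ge0_le_integral_sup => nu hnu; rewrite indicE.
  by rewrite mule_ge0 ?risk0// lee_fin.
have [/set_mem -> |_] := boolP (nu \in [set mu]); first by rewrite mule1.
by rewrite mule0 risk0.
Qed.

End UpperBound.

(** * The limit of the ratio of the two risks *)

Theorem theorem2p1 (R : realType) (p eta : R) (hp0 : 0 < p) (hp2 : p < 2)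
  (heta : 0 < eta) :
  (fun n : nat => fine (minimax_risk n p eta) / fine (minimax_bayes_risk n p eta))
    @ \oo --> (1 : R).
Proof.
have s0 : 0 < powR eta p by exact: powR_gt0.
have [v v0 hv] := game_value_gt0 p (powR eta p) hp0 s0.
apply/cvgrPdist_le => e e0.
(* The two risks will differ by at most [3 * e1]: one from the lower bound and two from the upper
   bound, where the slack [kap * s] equals [e1]. The first term of the minimum keeps both risks at
   least [v / 2]; the second gives [3 * e1 <= e * (v / 2)]. *)
pose e1 := Num.min (v / 2) (e * v / 6).
have e10 : 0 < e1.
  by rewrite /e1 lt_min !divr_gt0//= mulr_gt0.
have e1v : e1 <= v / 2 by rewrite /e1 ge_min lexx.
have e1e : e1 <= e * v / 6 by rewrite /e1 ge_min lexx orbT.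
have kap0 : 0 < e1 / powR eta p by exact: divr_gt0.
have [T [M [a [b [est [[T1 M2] [mest est0] b0 ab hrisk]]]]]] :=
  univariate_estimator p (powR eta p) e1 (e1 / powR eta p) hp0 s0 e10 kap0.
have M1 : 1 <= M by apply: le_trans M2; rewrite ler1n.
have [N hN] := minimax_risk_lower T M p eta e1 (le_trans ler01 T1) M1 hp0 heta e10.
have vV := hv T M T1 M2.
rewrite divfK ?gt_eqF// in ab.
exists (maxn N 1) => // n /=; rewrite geq_max => /andP[Nn n0].
have lower := hN n Nn.
have upper := minimax_bayes_coordwise_le n est p a b (powR eta p)
  n0 mest est0 b0 hrisk eta erefl.
have := minimax_le_bayes n p eta.
move: lower upper.
set V := game_value _ _ _ _ in vV ab *.
(* The real bounds on both sides exclude infinite values, so [fine] returns the true risks. *)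
case: (minimax_risk n p eta) => [x||] //; case: (minimax_bayes_risk n p eta) => [y||] //.
rewrite !lee_fin /= => Vx yab xy.
have x0 : 0 < x by lra.
have y0 : 0 < y by exact: lt_le_trans xy.
have -> : 1 - x / y = (y - x) / y by field; rewrite gt_eqF.
rewrite ger0_norm; last by apply: divr_ge0; [rewrite subr_ge0 | exact: ltW].
rewrite ler_pdivrMr//.
have : e * (v / 2) <= e * y by rewrite ler_pM2l//; lra.
lra.
Qed.
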